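(* Let $f\in C^1(\mathbb{R})$ satisfy (f1), $f_0\in(0,+\infty)$, $f_\infty=0$, $f'(s)<Nf(s)/s$ for all $s>0$, $f'(s)>Nf(s)/s$ for all $s<0$, and in addition $f\ge0$. Then for every $\lambda\in(\lambda_1/f_0,+\infty)$, problem (MO) has exactly one nontrivial solution $u_\lambda^-$ which is negative and strictly convex in $(0,1)$, and $u_\lambda^-$ is decreasing with respect to $\lambda$. Moreover, (MO) has no strictly convex solution for any $\lambda\in(0,\lambda_1/f_0]$.
   Context: Let $N\ge1$ be an integer. For $\lambda\ge0$, problem (MO) is: find $u\in C^2[0,1]$ with $\left((u')^N\right)'=\lambda^N N r^{N-1}f(-u)$ in $(0,1)$, $u'(0)=u(1)=0$. Condition (f1): $f(s)s^N>0$ for $s\neq0$. $f_0^N=\lim_{s\to0}f(s)/s^N$, $f_\infty^N=\lim_{|s|\to\infty}f(s)/s^N$. $\lambda_1>0$ is the first eigenvalue of $\left((-v')^N\right)'=\lambda^N N r^{N-1}v^N$ in $(0,1)$, $v'(0)=v(1)=0$, i.e. the unique $\lambda>0$ for which this problem has a solution positive in $(0,1)$. *)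

(* Defs.v *)
From Stdlib Require Import Reals.
Open Scope R_scope.

Definition deriv_within (D : R -> Prop) (g : R -> R) (x l : R) : Prop :=
  limit1_in (fun h => (g h - g x) / (h - x)) (fun h => D h /\ h <> x) l x.

Definition I01 (x : R) : Prop := 0 <= x <= 1.

Definition C2_01_with (u u1 u2 : R -> R) : Prop :=
  (forall x, I01 x -> deriv_within I01 u x (u1 x)) /\
  (forall x, I01 x -> deriv_within I01 u1 x (u2 x)) /\
  (forall x, I01 x -> limit1_in u2 I01 (u2 x) x).

Definition MO_sol (N : nat) (f : R -> R) (lam : R) (u : R -> R) : Prop :=
  exists u1 u2 : R -> R,
    C2_01_with u u1 u2 /\
    (forall r, 0 < r < 1 ->
       derivable_pt_lim (fun s => (u1 s) ^ N) r
         (lam ^ N * INR N * r ^ (N - 1) * f (- u r))) /\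
    u1 0 = 0 /\ u 1 = 0.

Definition eig_sol (N : nat) (lam : R) (v : R -> R) : Prop :=
  exists v1 v2 : R -> R,
    C2_01_with v v1 v2 /\
    (forall r, 0 < r < 1 ->
       derivable_pt_lim (fun s => (- v1 s) ^ N) r
         (lam ^ N * INR N * r ^ (N - 1) * (v r) ^ N)) /\
    v1 0 = 0 /\ v 1 = 0.

Definition pos_eig (N : nat) (lam : R) : Prop :=
  exists v, eig_sol N lam v /\ (forall r, 0 < r < 1 -> 0 < v r).

Definition is_first_eigenvalue (N : nat) (lam1 : R) : Prop :=
  0 < lam1 /\ pos_eig N lam1 /\
  (forall lam, 0 < lam -> pos_eig N lam -> lam = lam1).

Definition nontrivial01 (u : R -> R) : Prop := exists r, I01 r /\ u r <> 0.

Definition negative01 (u : R -> R) : Prop := forall r, 0 < r < 1 -> u r < 0.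

Definition strictly_convex01 (u : R -> R) : Prop :=
  forall x y t, 0 < x < 1 -> 0 < y < 1 -> x <> y -> 0 < t < 1 ->
    u (t * x + (1 - t) * y) < t * u x + (1 - t) * u y.

(* the class in which u_lambda^- is unique *)
Definition neg_convex_sol (N : nat) (f : R -> R) (lam : R) (u : R -> R) : Prop :=
  MO_sol N f lam u /\ nontrivial01 u /\ negative01 u /\ strictly_convex01 u.

(* Main.v *)
Require Import Defs.
From Stdlib Require Import Reals Lra Lia Psatz Ranalysis5.
From Coquelicot Require Import Coquelicot.
Open Scope R_scope.

(** Since [f >= 0], condition (f1) forces [N] to be even.  For a negative convex
    solution put [w = -u] and [y = u' = -w'], so that
    [(y^N)' = N r^(N-1) c] with [c = lam^N f(w)].  For two such profiles the
    Picone-type expression [E = w1^(N+1) y2^N / w2^N - w1 y1^N] satisfies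
    [E' = N r^(N-1) w1 (c2 w1^N / w2^N - c1)
          + (N X^(N+1) - (N+1) y1 X^N + y1^(N+1))] with [X = w1 y2 / w2],
    where the last bracket is nonnegative by Young's inequality.  As [f(s)/s^N] is
    decreasing, [E] increases strictly between two crossings of [w1] and [w2]
    with [w1 > w2] (or up to [r = 1], where [E] tends to [0]), whereas its boundary
    values have the opposite signs.  This yields uniqueness and monotonicity in
    [lam]; comparison with the first eigenfunction gives nonexistence for
    [lam <= lam1 / f0].  Existence is by shooting from [w(0) = a]: the integral
    equation is a contraction for an exponentially weighted norm, and [w(1)]
    depends continuously on [a], is positive for large [a] because [f_oo = 0], and is
    negative for small [a] by comparison with the first eigenfunction. *)

(** * Monotonicity from derivatives *)

(** Both endpoints are degenerate. At [r = 1] the quotient in [E] may become [0 / 0]; linear bounds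
    on the profiles near [1], which come from the monotonicity of [y], keep it under control. A
    profile only has [0 <= w 1], so that a shot merely supposed nonnegative at [1] can also be
    compared with the eigenfunction. At [r = 0] the [N]-th root that recovers [y] from [y^N] is not
    Lipschitz for [N > 1], and a plain Picard estimate fails. Shots from at least [amin > 0] have
    source terms bounded below near [0], so that [y] grows at least linearly; the power [t^(N-1)]
    lost by the root is then regained from the [t^N] in the integrated equation. The same scaling,
    dividing [y] by [r], shows that the solution is [C^2] up to [0]. For shooting, [f] is frozen
    outside some [[0, B]]; this is harmless, since shots decrease from a value at most [B]. *)

Lemma mvt_open (F dF : R -> R) (a b : R) :
  a < b ->
  (forall x, a <= x <= b -> continuity_pt F x) ->
  (forall x, a < x < b -> is_derive F x (dF x)) ->
  exists c, a < c < b /\ F b - F a = dF c * (b - a).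
Proof.
intros Hab Hc Hd.
assert (pr1 : forall c, a < c < b -> derivable_pt F c).
{ intros c Hc'; exists (dF c); apply is_derive_Reals; auto. }
assert (pr2 : forall c, a < c < b -> derivable_pt id c).
{ intros c _; apply derivable_pt_id. }
destruct (MVT F id a b pr1 pr2 Hab Hc) as [c [P Heq]].
{ intros c _; apply derivable_continuous_pt, derivable_pt_id. }
exists c; split; [exact P|].
assert (H1 : derive_pt F c (pr1 c P) = dF c).
{ apply derive_pt_eq_0, is_derive_Reals; auto. }
assert (H2 : derive_pt id c (pr2 c P) = 1).
{ apply derive_pt_eq_0, derivable_pt_lim_id. }
rewrite H1, H2 in Heq; unfold id in Heq; lra.
Qed.

Lemma derive_pos_incr (F dF : R -> R) (a b : R) :
  a < b ->
  (forall x, a <= x <= b -> continuity_pt F x) ->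
  (forall x, a < x < b -> is_derive F x (dF x)) ->
  (forall x, a < x < b -> 0 < dF x) ->
  F a < F b.
Proof.
intros Hab Hc Hd Hp.
destruct (mvt_open F dF a b Hab Hc Hd) as [c [Hcab Heq]].
specialize (Hp c Hcab); nra.
Qed.

Lemma derive_le_incr (F G dF dG : R -> R) (a b : R) :
  a <= b ->
  (forall x, a <= x <= b -> continuity_pt F x) ->
  (forall x, a <= x <= b -> continuity_pt G x) ->
  (forall x, a < x < b -> is_derive F x (dF x)) ->
  (forall x, a < x < b -> is_derive G x (dG x)) ->
  (forall x, a < x < b -> dF x <= dG x) ->
  F b - F a <= G b - G a.
Proof.
intros [Hab | ->] HF HG HdF HdG Hle; [|lra].
destruct (mvt_open (fun x => G x - F x) (fun x => dG x - dF x) a b Hab)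
  as [c [Hcab Heq]].
- intros x Hx; apply (continuity_pt_minus G F); auto.
- intros x Hx; apply (is_derive_minus G F); auto.
- specialize (Hle c Hcab); nra.
Qed.

Lemma continuity_pt_pow_comp (F : R -> R) (n : nat) (x : R) :
  continuity_pt F x -> continuity_pt (fun t => F t ^ n) x.
Proof.
intros H; apply (continuity_pt_comp F (fun t => t ^ n)); [exact H|].
apply derivable_continuous_pt, derivable_pt_pow.
Qed.

Lemma is_derive_pow_Rmult (F : R -> R) (dF x : R) (n : nat) :
  is_derive F x dF -> is_derive (fun t => F t ^ n) x (INR n * F x ^ (n - 1) * dF).
Proof.
intros H.
replace (INR n * F x ^ (n - 1) * dF) with (INR n * dF * F x ^ pred n).
- apply (is_derive_pow F n x dF H).
- replace (pred n) with (n - 1)%nat by lia; ring.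
Qed.

Lemma pow_lt_compat (n : nat) (x y : R) :
  (1 <= n)%nat -> 0 <= x < y -> x ^ n < y ^ n.
Proof.
intros Hn [Hx Hxy]; induction n as [|[|n] IH]; [lia|simpl; lra|].
assert (IH' : x ^ S n < y ^ S n) by (apply IH; lia).
assert (0 <= x ^ S n) by (apply pow_le; lra).
change (x * x ^ S n < y * y ^ S n); nra.
Qed.

Lemma pow_lt_reg (n : nat) (x y : R) : 0 <= y -> x ^ n < y ^ n -> x < y.
Proof.
intros Hy H; destruct (Rlt_le_dec x y) as [|Hle]; [assumption|].
assert (y ^ n <= x ^ n) by (apply pow_incr; lra); lra.
Qed.

Lemma pow_le_reg (n : nat) (x y : R) :
  (1 <= n)%nat -> 0 <= y -> x ^ n <= y ^ n -> x <= y.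
Proof.
intros Hn Hy H; destruct (Rle_lt_dec x y) as [|Hlt]; [assumption|].
assert (y ^ n < x ^ n) by (apply pow_lt_compat; [lia|lra]); lra.
Qed.

(** Weighted AM-GM in polynomial form: the expression for [S n] is [y] times the one for [n] plus
    [(n + 1) X^n (X - y)^2], so nonnegativity passes along the induction. *)
Lemma young_pow (n : nat) (X y : R) :
  0 <= X -> 0 <= y ->
  0 <= INR n * X ^ S n - INR (S n) * y * X ^ n + y ^ S n.
Proof.
intros HX Hy; induction n as [|n IH]; [simpl; lra|].
replace (INR (S n) * X ^ S (S n) - INR (S (S n)) * y * X ^ S n + y ^ S (S n))
  with (y * (INR n * X ^ S n - INR (S n) * y * X ^ n + y ^ S n)
        + INR (S n) * X ^ n * (X - y) ^ 2)
  by (rewrite !S_INR; simpl; ring).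
assert (0 <= INR (S n)) by apply pos_INR.
assert (0 <= X ^ n) by (apply pow_le; lra).
assert (0 <= (X - y) ^ 2) by apply pow2_ge_0.
apply Rplus_le_le_0_compat; [nra|].
apply Rmult_le_pos; [nra|assumption].
Qed.

(** * Profiles and the Picone identity *)

(* A decreasing solution [w] of [((-w')^N)' = N r^(N-1) c], with [y = -w']. *)
Record profile (N : nat) (c w y : R -> R) : Prop := {
  prof_w_cont : continuity w;
  prof_y_cont : continuity y;
  prof_w_der : forall r, 0 < r < 1 -> is_derive w r (- y r);
  prof_yN_der : forall r, 0 < r < 1 ->
    is_derive (fun s => y s ^ N) r (INR N * r ^ (N - 1) * c r);
  prof_y0 : y 0 = 0;
  prof_y_pos : forall r, 0 < r < 1 -> 0 < y r;
  prof_w_pos : forall r, 0 < r < 1 -> 0 < w r;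
  prof_c_pos : forall r, 0 < r < 1 -> 0 < c r;
  prof_w1 : 0 <= w 1 }.

Section Profile.

Variables (N : nat) (c w y : R -> R).
Hypotheses (HN : (1 <= N)%nat) (P : profile N c w y).

Lemma INR_pow_pos (r : R) : 0 < r -> 0 < INR N * r ^ (N - 1).
Proof.
intros Hr; apply Rmult_lt_0_compat; [apply lt_0_INR; lia|now apply pow_lt].
Qed.

Lemma profile_decr (r s : R) : 0 <= r -> r < s -> s <= 1 -> w s < w r.
Proof.
intros Hr Hrs Hs.
destruct (mvt_open w (fun x => - y x) r s Hrs) as [d [Hd Heq]].
- intros x _; apply (prof_w_cont _ _ _ _ P).
- intros x Hx; apply (prof_w_der _ _ _ _ P); lra.
- assert (0 < y d) by (apply (prof_y_pos _ _ _ _ P); lra); nra.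
Qed.

Lemma profile_w_pos (r : R) : 0 <= r < 1 -> 0 < w r.
Proof.
intros Hr; assert (w 1 < w r) by (apply profile_decr; lra).
generalize (prof_w1 _ _ _ _ P); lra.
Qed.

Lemma profile_y_incr (r s : R) : 0 < r -> r <= s -> s < 1 -> y r <= y s.
Proof.
intros Hr [Hrs | ->] Hs; [|lra].
apply (pow_le_reg N); [exact HN| |].
- apply Rlt_le, (prof_y_pos _ _ _ _ P); lra.
- apply Rlt_le, (derive_pos_incr (fun x => y x ^ N)
    (fun x => INR N * x ^ (N - 1) * c x)); [lra| | |].
  + intros x _; apply continuity_pt_pow_comp, (prof_y_cont _ _ _ _ P).
  + intros x Hx; apply (prof_yN_der _ _ _ _ P); lra.
  + intros x Hx; apply Rmult_lt_0_compat; [apply INR_pow_pos; lra|].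
    apply (prof_c_pos _ _ _ _ P); lra.
Qed.

(** Comparing [N]-th powers compares the bases only once [0 <= y 1] is known; a profile records
    positivity inside only, and the sign at [1] follows by continuity. *)
Lemma profile_y_le1 (r : R) : 0 < r < 1 -> y r <= y 1.
Proof.
intros Hr; apply (pow_le_reg N); [exact HN| |].
- destruct (Rle_lt_dec 0 (y 1)) as [|Hneg]; [assumption|exfalso].
  destruct (prof_y_cont _ _ _ _ P 1 (- y 1)) as [d [Hd H]]; [lra|].
  pose (x := Rmax (1 / 2) (1 - d / 2)).
  assert (Hx : 1 / 2 <= x < 1 /\ 1 - d / 2 <= x).
  { unfold x, Rmax; destruct (Rle_dec (1 / 2) (1 - d / 2)); lra. }
  assert (Hy := prof_y_pos _ _ _ _ P x ltac:(lra)).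
  specialize (H x); simpl in H; unfold R_dist in H.
  assert (Rabs (y x - y 1) < - y 1).
  { apply H; split; [unfold D_x, no_cond; split; [exact I|lra]|].
    rewrite Rabs_left; lra. }
  generalize (Rle_abs (y x - y 1)); lra.
- apply Rlt_le, (derive_pos_incr (fun x => y x ^ N)
    (fun x => INR N * x ^ (N - 1) * c x)); [lra| | |].
  + intros x _; apply continuity_pt_pow_comp, (prof_y_cont _ _ _ _ P).
  + intros x Hx; apply (prof_yN_der _ _ _ _ P); lra.
  + intros x Hx; apply Rmult_lt_0_compat; [apply INR_pow_pos; lra|].
    apply (prof_c_pos _ _ _ _ P); lra.
Qed.

(** A Hopf-type bound: [y] is nondecreasing, so [w] descends to its value at [1] with slope at least
    [y (1 / 2)]. It keeps [w1 / w2] bounded near [1] even if [w2 1 = 0]. *)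
Lemma profile_w_lower (r : R) : 1 / 2 < r < 1 -> y (1 / 2) * (1 - r) <= w r.
Proof.
intros Hr.
destruct (mvt_open w (fun x => - y x) r 1) as [d [Hd Heq]]; [lra| | |].
- intros x _; apply (prof_w_cont _ _ _ _ P).
- intros x Hx; apply (prof_w_der _ _ _ _ P); lra.
- assert (y (1 / 2) <= y d) by (apply profile_y_incr; lra).
  generalize (prof_w1 _ _ _ _ P); nra.
Qed.

Lemma profile_w_upper (r : R) : 0 < r < 1 -> w r <= w 1 + y 1 * (1 - r).
Proof.
intros Hr.
destruct (mvt_open w (fun x => - y x) r 1) as [d [Hd Heq]]; [lra| | |].
- intros x _; apply (prof_w_cont _ _ _ _ P).
- intros x Hx; apply (prof_w_der _ _ _ _ P); lra.
- assert (y d <= y 1) by (apply profile_y_le1; lra); nra.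
Qed.

End Profile.

Definition picone (N : nat) (w1 y1 w2 y2 : R -> R) (r : R) : R :=
  w1 r ^ S N * y2 r ^ N / w2 r ^ N - w1 r * y1 r ^ N.

Section Picone.

Variables (N : nat) (c1 w1 y1 c2 w2 y2 : R -> R).
Hypotheses (HN : (1 <= N)%nat).
Hypotheses (P1 : profile N c1 w1 y1) (P2 : profile N c2 w2 y2).

Lemma picone_cont (r : R) : 0 <= r < 1 -> continuity_pt (picone N w1 y1 w2 y2) r.
Proof.
intros Hr; unfold picone.
apply (continuity_pt_minus (fun s => w1 s ^ S N * y2 s ^ N / w2 s ^ N)
         (fun s => w1 s * y1 s ^ N)).
- apply (continuity_pt_div (fun s => w1 s ^ S N * y2 s ^ N) (fun s => w2 s ^ N)).
  + apply (continuity_pt_mult (fun s => w1 s ^ S N) (fun s => y2 s ^ N)).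
    * apply continuity_pt_pow_comp, (prof_w_cont _ _ _ _ P1).
    * apply continuity_pt_pow_comp, (prof_y_cont _ _ _ _ P2).
  + apply continuity_pt_pow_comp, (prof_w_cont _ _ _ _ P2).
  + apply pow_nonzero, Rgt_not_eq, (profile_w_pos N c2 w2 y2 P2); lra.
- apply (continuity_pt_mult w1 (fun s => y1 s ^ N)).
  + apply (prof_w_cont _ _ _ _ P1).
  + apply continuity_pt_pow_comp, (prof_y_cont _ _ _ _ P1).
Qed.

Lemma picone_derive (r : R) : 0 < r < 1 ->
  is_derive (picone N w1 y1 w2 y2) r
    (INR N * r ^ (N - 1) * w1 r / w2 r ^ N * (c2 r * w1 r ^ N - c1 r * w2 r ^ N)
     + (INR N * (w1 r * y2 r / w2 r) ^ S N
        - INR (S N) * y1 r * (w1 r * y2 r / w2 r) ^ N + y1 r ^ S N)).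
Proof.
intros Hr.
assert (Hw2 : 0 < w2 r) by (apply (prof_w_pos _ _ _ _ P2); lra).
assert (Hd1 := prof_w_der _ _ _ _ P1 r Hr).
assert (Hd2 := prof_w_der _ _ _ _ P2 r Hr).
assert (HY1 := prof_yN_der _ _ _ _ P1 r Hr).
assert (HY2 := prof_yN_der _ _ _ _ P2 r Hr).
assert (Hw2N : w2 r ^ N <> 0) by (apply pow_nonzero; lra).
unfold picone.
evar_last.
- apply (is_derive_minus (fun s => w1 s ^ S N * y2 s ^ N / w2 s ^ N)
           (fun s => w1 s * y1 s ^ N)).
  + apply (is_derive_div (fun s => w1 s ^ S N * y2 s ^ N) (fun s => w2 s ^ N)).
    * apply (is_derive_mult (fun s => w1 s ^ S N) (fun s => y2 s ^ N)).
      -- apply is_derive_pow_Rmult, Hd1.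
      -- exact HY2.
      -- intros; apply Rmult_comm.
    * apply is_derive_pow_Rmult, Hd2.
    * exact Hw2N.
  + apply (is_derive_mult w1 (fun s => y1 s ^ N)); [exact Hd1|exact HY1|].
    intros; apply Rmult_comm.
- unfold minus, plus, opp, mult; cbn -[pow INR Nat.sub].
  replace (S N - 1)%nat with N by lia.
  destruct N as [|n]; [lia|].
  replace (S n - 1)%nat with n in * by lia.
  unfold Rdiv; rewrite !Rpow_mult_distr, !pow_inv.
  rewrite <- !tech_pow_Rmult, ?S_INR.
  field; split; try (apply pow_nonzero); lra.
Qed.

Lemma picone_lt (r s : R) :
  0 <= r -> r < s -> s < 1 ->
  (forall t, r < t < s -> c1 t * w2 t ^ N < c2 t * w1 t ^ N) ->
  picone N w1 y1 w2 y2 r < picone N w1 y1 w2 y2 s.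
Proof.
intros Hr Hrs Hs Hc.
eapply derive_pos_incr; [exact Hrs| | |].
- intros x Hx; apply picone_cont; lra.
- intros x Hx; apply picone_derive; lra.
- intros x Hx; cbv beta.
  assert (Hx' : 0 < x < 1) by lra.
  assert (Hw1 := prof_w_pos _ _ _ _ P1 x Hx').
  assert (Hw2 := prof_w_pos _ _ _ _ P2 x Hx').
  assert (Hy1 := prof_y_pos _ _ _ _ P1 x Hx').
  assert (Hy2 := prof_y_pos _ _ _ _ P2 x Hx').
  apply Rplus_lt_le_0_compat.
  + apply Rmult_lt_0_compat; [|specialize (Hc x Hx); lra].
    apply Rdiv_lt_0_compat; [|now apply pow_lt].
    apply Rmult_lt_0_compat; [apply INR_pow_pos; [exact HN|lra]|lra].
  + apply young_pow; [|lra].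
    apply Rlt_le, Rdiv_lt_0_compat; [nra|lra].
Qed.

(** The linear bounds near [1] give [w1 / w2 <= y1 1 / y2 (1 / 2)], and the subtracted term is
    dropped. One factor [w1] survives and sends the bound to [0] at [1]. *)
Lemma picone_upper (r : R) : 1 / 2 < r < 1 -> w1 1 = 0 ->
  picone N w1 y1 w2 y2 r <= w1 r * (y1 1 / y2 (1 / 2) * y2 1) ^ N.
Proof.
intros Hr H1; unfold picone.
assert (Hr' : 0 < r < 1) by lra.
assert (Hw1 := prof_w_pos _ _ _ _ P1 r Hr').
assert (Hw2 := prof_w_pos _ _ _ _ P2 r Hr').
assert (Hy1 := prof_y_pos _ _ _ _ P1 r Hr').
assert (Hy2 := prof_y_pos _ _ _ _ P2 r Hr').
assert (Hyh := prof_y_pos _ _ _ _ P2 (1 / 2) ltac:(lra)).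
assert (Hl := profile_w_lower N c2 w2 y2 HN P2 r Hr).
assert (Hu := profile_w_upper N c1 w1 y1 HN P1 r Hr').
assert (Hy21 := profile_y_le1 N c2 w2 y2 HN P2 r Hr').
assert (Hy11 := profile_y_le1 N c1 w1 y1 HN P1 r Hr').
rewrite H1, Rplus_0_l in Hu.
assert (Hq : w1 r / w2 r <= y1 1 / y2 (1 / 2)).
{ apply Rle_div_l; [lra|].
  replace (y1 1 / y2 (1 / 2) * w2 r) with (y1 1 * (w2 r / y2 (1/2))) by (field; lra).
  apply Rle_trans with (1 := Hu).
  apply Rmult_le_compat_l; [lra|].
  apply Rle_div_r; lra. }
assert (Hq0 : 0 < w1 r / w2 r) by (apply Rdiv_lt_0_compat; lra).
replace (w1 r ^ S N * y2 r ^ N / w2 r ^ N) with (w1 r * (w1 r / w2 r * y2 r) ^ N).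
- assert ((w1 r / w2 r * y2 r) ^ N <= (y1 1 / y2 (1 / 2) * y2 1) ^ N).
  { apply pow_incr; split; [nra|]. apply Rmult_le_compat; lra. }
  assert (0 < y1 r ^ N) by now apply pow_lt.
  nra.
- unfold Rdiv; rewrite !Rpow_mult_distr, pow_inv; simpl; field.
  apply pow_nonzero; lra.
Qed.

(** A nonnegative value at [r] would, by strict growth, leave a positive floor [d] up to [1],
    against the bound [w1 * K], which tends to [0]. *)
Lemma picone_lt_right (r : R) :
  0 <= r < 1 -> w1 1 = 0 ->
  (forall t, r < t < 1 -> c1 t * w2 t ^ N < c2 t * w1 t ^ N) ->
  picone N w1 y1 w2 y2 r < 0.
Proof.
intros Hr H1 Hc.
apply Rnot_le_lt; intros Hge.
(* Moving on to [s] turns the nonnegative value at [r] into a positive one, and [1 / 2 <= s] makes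
   [picone_upper] available beyond it. *)
pose (s := Rmax (1 / 2) ((1 + r) / 2)).
assert (Hs : 1 / 2 <= s < 1 /\ r < s).
{ unfold s, Rmax; destruct (Rle_dec (1 / 2) ((1 + r) / 2)); lra. }
assert (Hd : 0 < picone N w1 y1 w2 y2 s).
{ apply Rle_lt_trans with (1 := Hge), picone_lt; try lra.
  intros t Ht; apply Hc; lra. }
set (K := (y1 1 / y2 (1 / 2) * y2 1) ^ N).
set (d := picone N w1 y1 w2 y2 s) in *.
assert (Hlow : forall t, s < t < 1 -> d <= w1 t * K).
{ intros t Ht; apply Rle_trans with (picone N w1 y1 w2 y2 t).
  - apply Rlt_le, picone_lt; try lra; intros x Hx; apply Hc; lra.
  - apply picone_upper; [lra|exact H1]. }
assert (HK : 0 < K).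
{ specialize (Hlow ((s + 1) / 2) ltac:(lra)).
  assert (0 < w1 ((s + 1) / 2)) by (apply (prof_w_pos _ _ _ _ P1); lra).
  destruct (Rle_lt_dec K 0); nra. }
destruct (prof_w_cont _ _ _ _ P1 1 (d / K)) as [e [He H]];
  [now apply Rdiv_lt_0_compat|].
pose (t := Rmax ((s + 1) / 2) (1 - e / 2)).
assert (Ht : (s + 1) / 2 <= t < 1 /\ 1 - e / 2 <= t).
{ unfold t, Rmax; destruct (Rle_dec ((s + 1) / 2) (1 - e / 2)); lra. }
specialize (H t); simpl in H; unfold R_dist in H.
assert (Ha : Rabs (w1 t - w1 1) < d / K).
{ apply H; split; [unfold D_x, no_cond; split; [exact I|lra]|].
  rewrite Rabs_left; lra. }
rewrite H1, Rminus_0_r in Ha.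
assert (Hb := Rle_abs (w1 t)).
specialize (Hlow t ltac:(lra)).
assert (w1 t * K < d); [|lra].
apply Rlt_div_r; lra.
Qed.

End Picone.

(** * Comparison of profiles *)

(** [c] is the supremum of [E]; adjoining [a] keeps [E] nonempty and accounts for the alternative
    [c = a]. Otherwise [h c < 0] contradicts positivity to the right of [c], and [h c > 0]
    contradicts leastness. *)
Lemma last_nonpos_before (h : R -> R) (a b : R) :
  continuity h -> a <= b -> 0 < h b ->
  exists c, a <= c <= b /\ (c = a \/ h c = 0) /\ (forall t, c < t <= b -> 0 < h t).
Proof.
intros Hc Hab Hb.
pose (E := fun x => x = a \/ (a <= x <= b /\ h x <= 0)).
destruct (completeness E) as [c [Hub Hlub]].
- exists b; intros x [-> | Hx]; lra.
- exists a; now left.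
- assert (Hac : a <= c) by (apply Hub; now left).
  assert (Hcb : c <= b) by (apply Hlub; intros x [-> | Hx]; lra).
  assert (Hpos : forall t, c < t <= b -> 0 < h t).
  { intros t Ht; apply Rnot_le_lt; intros Hle.
    assert (t <= c) by (apply Hub; right; lra); lra. }
  exists c; split; [lra|split; [|exact Hpos]].
  destruct (Req_dec c a) as [|Hne]; [now left|right].
  destruct (Rtotal_order (h c) 0) as [Hlt | [|Hgt]]; [|assumption|].
  + destruct (Hc c (- h c)) as [d [Hd H]]; [lra|].
    assert (Hcb' : c < b).
    { destruct (Req_dec c b) as [->|]; lra. }
    pose (t := Rmin b (c + d / 2)).
    assert (Ht : c < t <= b /\ t <= c + d / 2).
    { unfold t, Rmin; destruct (Rle_dec b (c + d / 2)); lra. }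
    specialize (H t); simpl in H; unfold R_dist in H.
    assert (Ha : Rabs (h t - h c) < - h c).
    { apply H; split; [unfold D_x, no_cond; split; [exact I|lra]|].
      rewrite Rabs_pos_eq; lra. }
    generalize (Rle_abs (h t - h c)) (Hpos t ltac:(lra)); lra.
  + destruct (Hc c (h c)) as [d [Hd H]]; [lra|].
    pose (m := Rmax a (c - d / 2)).
    assert (Hm : a <= m < c /\ c - d / 2 <= m).
    { unfold m, Rmax; destruct (Rle_dec a (c - d / 2)); lra. }
    assert (c <= m); [|lra].
    apply Hlub; intros x Hx.
    assert (Hxc : x <= c) by (apply Hub; exact Hx).
    destruct Hx as [-> | [Hx Hhx]]; [lra|].
    apply Rnot_lt_le; intros Hmx.
    destruct (Req_dec x c) as [-> |Hxne]; [lra|].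
    specialize (H x); simpl in H; unfold R_dist in H.
    assert (Ha : Rabs (h x - h c) < h c).
    { apply H; split; [unfold D_x, no_cond; split; [exact I|lra]|].
      rewrite Rabs_left; lra. }
    generalize (Rle_abs (- (h x - h c))); rewrite Rabs_Ropp; lra.
Qed.

Lemma continuity_reflect (h : R -> R) :
  continuity h -> continuity (fun t => h (- t)).
Proof.
intros Hc x; apply (continuity_pt_comp Ropp h); [|apply Hc].
apply derivable_continuous_pt; exists (- 1); apply is_derive_Reals.
auto_derive; trivial.
Qed.

Lemma first_nonpos_after (h : R -> R) (a b : R) :
  continuity h -> a <= b -> 0 < h a ->
  exists c, a <= c <= b /\ (c = b \/ h c = 0) /\ (forall t, a <= t < c -> 0 < h t).
Proof.
intros Hc Hab Ha.
destruct (last_nonpos_before (fun t => h (- t)) (- b) (- a))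
  as [c [H1 [H2 H3]]]; [now apply continuity_reflect|lra|now rewrite Ropp_involutive|].
exists (- c); split; [lra|split].
- destruct H2 as [-> | H2]; [left; lra|now right].
- intros t Ht; rewrite <- (Ropp_involutive t); apply H3; lra.
Qed.

Lemma derive_nonneg_right (h : R -> R) (x l b : R) :
  x < b -> is_derive h x l -> h x = 0 -> (forall t, x < t < b -> 0 < h t) -> 0 <= l.
Proof.
intros Hxb Hd Hx Hpos; apply Rnot_lt_le; intros Hl.
apply is_derive_Reals in Hd.
destruct (Hd (- l) ltac:(lra)) as [d H].
pose (k := Rmin (d / 2) ((b - x) / 2)).
assert (Hdp := cond_pos d).
assert (Hk : 0 < k /\ k <= d / 2 /\ k <= (b - x) / 2).
{ unfold k, Rmin; destruct (Rle_dec (d / 2) ((b - x) / 2)); lra. }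
specialize (H k ltac:(lra)); rewrite Rabs_pos_eq in H by lra.
specialize (H ltac:(lra)).
assert (0 < h (x + k) / k) by (apply Rdiv_lt_0_compat; [apply Hpos; lra|lra]).
rewrite Hx, Rminus_0_r in H.
generalize (Rle_abs (h (x + k) / k - l)); lra.
Qed.

Lemma derive_nonpos_left (h : R -> R) (x l a : R) :
  a < x -> is_derive h x l -> h x = 0 -> (forall t, a < t < x -> 0 < h t) -> l <= 0.
Proof.
intros Hax Hd Hx Hpos.
assert (0 <= - l); [|lra].
apply (derive_nonneg_right (fun t => h (- t)) (- x) (- l) (- a)); [lra| | |].
- evar_last.
  + apply (is_derive_comp h Ropp).
    * rewrite Ropp_involutive; exact Hd.
    * apply is_derive_Reals, derivable_pt_lim_opp, derivable_pt_lim_id.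
  + unfold scal; simpl; unfold mult; simpl; ring.
- now rewrite Ropp_involutive.
- intros t Ht; apply Hpos; lra.
Qed.

(** The coefficient condition is asked only where [w2 < w1], since [E] is followed only on the
    interval of strict inequality around a supposed counterexample. There the decreasing quotient of
    [f] has the right direction. *)
Lemma profile_compare (N : nat) (c1 w1 y1 c2 w2 y2 : R -> R) :
  (1 <= N)%nat -> profile N c1 w1 y1 -> profile N c2 w2 y2 -> w1 1 = 0 ->
  (forall t, 0 < t < 1 -> w2 t < w1 t -> c1 t * w2 t ^ N < c2 t * w1 t ^ N) ->
  forall r, 0 <= r <= 1 -> w1 r <= w2 r.
Proof.
intros HN P1 P2 H1 Hc r1 Hr1; apply Rnot_lt_le; intros Hlt.
assert (Hr1' : r1 < 1).
{ destruct (Req_dec r1 1) as [-> |]; [|lra].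
  generalize (prof_w1 _ _ _ _ P2); lra. }
pose (h := fun t => w1 t - w2 t).
assert (Hh : continuity h).
{ apply continuity_minus; [apply (prof_w_cont _ _ _ _ P1)|apply (prof_w_cont _ _ _ _ P2)]. }
assert (Hhd : forall x, 0 < x < 1 -> is_derive h x (y2 x - y1 x)).
{ intros x Hx; evar_last.
  - apply (is_derive_minus w1 w2);
      [apply (prof_w_der _ _ _ _ P1 x Hx)|apply (prof_w_der _ _ _ _ P2 x Hx)].
  - unfold minus, plus, opp; simpl; ring. }
destruct (last_nonpos_before h 0 r1 Hh) as [r0 [Hr0 [Hz0 Hp0]]];
  [lra|unfold h; lra|].
destruct (first_nonpos_after h r1 1 Hh) as [r2 [Hr2 [Hz2 Hp2]]];
  [lra|unfold h; lra|].
assert (Hp : forall t, r0 < t < r2 -> 0 < h t).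
{ intros t Ht; destruct (Rle_lt_dec t r1); [apply Hp0|apply Hp2]; lra. }
assert (Hcc : forall t, r0 < t < r2 -> c1 t * w2 t ^ N < c2 t * w1 t ^ N).
{ intros t Ht; apply Hc; [lra|]. specialize (Hp t Ht); unfold h in Hp; lra. }
assert (Hr1p : 0 < h r1) by (unfold h; lra).
(* At a crossing [w1^N / w2^N] is [1], so the sign of [E] is decided by [y2 - y1], that is, by the
   derivative of [h]. *)
assert (Hcross : forall x, 0 < x < 1 -> h x = 0 ->
          picone N w1 y1 w2 y2 x = w1 x * (y2 x ^ N - y1 x ^ N)).
{ intros x Hx Hhx; unfold h in Hhx; unfold picone.
  assert (0 < w2 x) by (apply (prof_w_pos _ _ _ _ P2); lra).
  replace (w1 x) with (w2 x) by lra; simpl; field; apply pow_nonzero; lra. }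
assert (E0 : 0 <= picone N w1 y1 w2 y2 r0).
{ destruct (Req_dec r0 0) as [-> |Hne].
  (* No crossing is known at [0], but both [y] vanish there and so does [E]. *)
  - unfold picone; rewrite (prof_y0 _ _ _ _ P1), (prof_y0 _ _ _ _ P2).
    rewrite pow_i by lia; unfold Rdiv; lra.
  - destruct Hz0 as [|Hz0]; [lra|].
    assert (Hr0r1 : r0 < r1).
    { destruct (Req_dec r0 r1) as [-> |]; lra. }
    rewrite Hcross; [|lra|exact Hz0].
    assert (0 <= y2 r0 - y1 r0).
    { apply (derive_nonneg_right h r0 _ r1); [exact Hr0r1|apply Hhd; lra|exact Hz0|].
      intros t Ht; apply Hp0; lra. }
    assert (0 < w1 r0) by (apply (prof_w_pos _ _ _ _ P1); lra).
    assert (0 < y1 r0) by (apply (prof_y_pos _ _ _ _ P1); lra).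
    assert (y1 r0 ^ N <= y2 r0 ^ N) by (apply pow_incr; lra).
    nra. }
destruct (Req_dec r2 1) as [-> |Hne].
- assert (picone N w1 y1 w2 y2 r0 < 0); [|lra].
  apply (picone_lt_right N c1 w1 y1 c2 w2 y2 HN P1 P2); [lra|exact H1|exact Hcc].
- destruct Hz2 as [|Hz2]; [lra|].
  assert (Hr1r2 : r1 < r2).
  { destruct (Req_dec r1 r2) as [Heq |]; [rewrite Heq in Hr1p; lra|lra]. }
  assert (Hlt2 : picone N w1 y1 w2 y2 r0 < picone N w1 y1 w2 y2 r2).
  { apply (picone_lt N c1 w1 y1 c2 w2 y2 HN P1 P2); [lra|lra|lra|exact Hcc]. }
  rewrite (Hcross r2) in Hlt2; [|lra|exact Hz2].
  assert (y2 r2 - y1 r2 <= 0).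
  { apply (derive_nonpos_left h r2 _ r1); [exact Hr1r2|apply Hhd; lra|exact Hz2|].
    intros t Ht; apply Hp2; lra. }
  assert (0 < w1 r2) by (apply (prof_w_pos _ _ _ _ P1); lra).
  assert (0 < y2 r2) by (apply (prof_y_pos _ _ _ _ P2); lra).
  assert (y2 r2 ^ N <= y1 r2 ^ N) by (apply pow_incr; lra).
  nra.
Qed.

(** [E] vanishes at [0] whatever the initial values are, so no ordering of [w1] and [w2] is needed.
    The eigenfunction serves as first profile against small shots and as second profile for
    nonexistence. *)
Lemma profile_no_strict_sub (N : nat) (c1 w1 y1 c2 w2 y2 : R -> R) :
  (1 <= N)%nat -> profile N c1 w1 y1 -> profile N c2 w2 y2 -> w1 1 = 0 ->
  (forall t, 0 < t < 1 -> c1 t * w2 t ^ N < c2 t * w1 t ^ N) -> False.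
Proof.
intros HN P1 P2 H1 Hc.
assert (H := picone_lt_right N c1 w1 y1 c2 w2 y2 HN P1 P2 0 ltac:(lra) H1 Hc).
unfold picone in H; rewrite (prof_y0 _ _ _ _ P1), (prof_y0 _ _ _ _ P2) in H.
rewrite pow_i in H by lia; unfold Rdiv in H; lra.
Qed.

(** * Profiles of solutions *)

(** Composition with this projection extends data on [[0, 1]] to functions continuous on the whole
    line; it also truncates [f] and the shooting parameter. *)
Definition clamp (a b x : R) : R := Rmax a (Rmin x b).

Lemma clamp_in (a b x : R) : a <= b -> a <= clamp a b x <= b.
Proof.
intros H; unfold clamp, Rmax, Rmin.
destruct (Rle_dec x b); destruct (Rle_dec a _); lra.
Qed.

Lemma clamp_id (a b x : R) : a <= x <= b -> clamp a b x = x.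
Proof.
intros H; unfold clamp, Rmax, Rmin.
destruct (Rle_dec x b); destruct (Rle_dec a _); lra.
Qed.

Lemma clamp_lipschitz (a b x y : R) :
  a <= b -> Rabs (clamp a b x - clamp a b y) <= Rabs (x - y).
Proof.
intros H; unfold clamp, Rmax, Rmin.
destruct (Rle_dec x b); destruct (Rle_dec y b);
  repeat (destruct (Rle_dec a _));
  unfold Rabs; repeat (destruct (Rcase_abs _)); lra.
Qed.

Lemma deriv_within_cont (g : R -> R) (x l : R) :
  I01 x -> deriv_within I01 g x l -> limit1_in g I01 (g x) x.
Proof.
intros Hx Hd eps Heps.
destruct (Hd 1 ltac:(lra)) as [d [Hdp H]]; simpl in *; unfold R_dist in *.
assert (Hl := Rabs_pos l).
pose (e := Rmin d (eps / (Rabs l + 1))).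
assert (He0 : 0 < eps / (Rabs l + 1)) by (apply Rdiv_lt_0_compat; lra).
assert (He : 0 < e /\ e <= d /\ e <= eps / (Rabs l + 1)).
{ unfold e, Rmin; destruct (Rle_dec d (eps / (Rabs l + 1))); lra. }
exists e; split; [lra|]; intros t [Ht Htx].
destruct (Req_dec t x) as [-> |Hne].
- rewrite Rminus_diag, Rabs_R0; exact Heps.
- assert (Htd : Rabs (t - x) < d) by lra; specialize (H t (conj (conj Ht Hne) Htd)).
  assert (Hq : Rabs ((g t - g x) / (t - x)) < Rabs l + 1).
  { generalize (Rabs_triang_inv ((g t - g x) / (t - x)) l); lra. }
  replace (g t - g x) with ((g t - g x) / (t - x) * (t - x)) by (field; lra).
  rewrite Rabs_mult.
  apply Rle_lt_trans with ((Rabs l + 1) * Rabs (t - x)).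
  + apply Rmult_le_compat_r; [apply Rabs_pos|lra].
  + rewrite Rmult_comm; apply Rlt_div_r; lra.
Qed.

Lemma continuity_clamp (g : R -> R) :
  (forall x, I01 x -> limit1_in g I01 (g x) x) -> continuity (fun x => g (clamp 0 1 x)).
Proof.
intros H x eps Heps.
assert (Hx : 0 <= clamp 0 1 x <= 1) by (apply clamp_in; lra).
destruct (H (clamp 0 1 x) Hx eps Heps) as [d [Hd Hd']].
exists d; split; [exact Hd|]; simpl in *; unfold R_dist in *.
intros t [_ Ht]; apply Hd'; split; [apply clamp_in; lra|].
apply Rle_lt_trans with (2 := Ht), clamp_lipschitz; lra.
Qed.

Lemma deriv_within_interior (g : R -> R) (x l : R) :
  0 < x < 1 -> deriv_within I01 g x l -> is_derive g x l.
Proof.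
intros Hx Hd; apply is_derive_Reals; intros eps Heps.
destruct (Hd eps Heps) as [d [Hdp H]]; simpl in *; unfold R_dist in *.
assert (He : 0 < Rmin d (Rmin x (1 - x))) by (repeat apply Rmin_pos; lra).
exists (mkposreal _ He); simpl; intros h Hh Hlt.
assert (H1 := Rmin_l d (Rmin x (1 - x))).
assert (H2 := Rmin_r d (Rmin x (1 - x))).
assert (H3 := Rmin_l x (1 - x)).
assert (H4 := Rmin_r x (1 - x)).
assert (Hab : - Rabs h <= h <= Rabs h).
{ generalize (Rle_abs h) (Rle_abs (- h)); rewrite Rabs_Ropp; lra. }
specialize (H (x + h)).
replace (x + h - x) with h in H by ring.
apply H; split; [split; [unfold I01; lra|lra]|lra].
Qed.

Lemma is_derive_clamp (g : R -> R) (x l : R) :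
  0 < x < 1 -> is_derive g x l -> is_derive (fun t => g (clamp 0 1 t)) x l.
Proof.
intros Hx; apply is_derive_ext_loc.
assert (He : 0 < Rmin x (1 - x)) by (apply Rmin_pos; lra).
exists (mkposreal _ He); intros t Ht.
unfold ball in Ht; simpl in Ht; unfold AbsRing_ball, abs, minus, plus, opp in Ht; simpl in Ht.
assert (H3 := Rmin_l x (1 - x)).
assert (H4 := Rmin_r x (1 - x)).
assert (Hab := Rle_abs (t + - x)).
assert (Hab' := Rle_abs (- (t + - x))); rewrite Rabs_Ropp in Hab'.
rewrite clamp_id; [reflexivity|lra].
Qed.

(* For even [N] the equation only sees [|y|]; the sign of [y] comes from
   [w > 0 = w 1]. *)
Lemma profile_intro (N : nat) (c w y : R -> R) :
  (1 <= N)%nat -> Nat.Even N ->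
  continuity w -> continuity y ->
  (forall r, 0 < r < 1 -> is_derive w r (- y r)) ->
  (forall r, 0 < r < 1 ->
    is_derive (fun s => y s ^ N) r (INR N * r ^ (N - 1) * c r)) ->
  y 0 = 0 -> w 1 = 0 ->
  (forall r, 0 < r < 1 -> 0 < w r) ->
  (forall r, 0 < r < 1 -> 0 < c r) ->
  profile N c w y.
Proof.
intros HN Hev Hw Hy Hdw Hdy Hy0 Hw1 Hwp Hcp.
(* [y ^ N] grows strictly from [0], so [y] has no interior zero and hence a single sign. *)
assert (Hy_ne : forall r, 0 < r < 1 -> y r <> 0).
{ intros r Hr Heq.
  assert (H : y 0 ^ N < y r ^ N).
  { apply (derive_pos_incr (fun x => y x ^ N)
      (fun x => INR N * x ^ (N - 1) * c x)); [lra| | |].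
    - intros x _; apply continuity_pt_pow_comp, Hy.
    - intros x Hx; apply Hdy; lra.
    - intros x Hx; apply Rmult_lt_0_compat; [apply INR_pow_pos; [exact HN|lra]|].
      apply Hcp; lra. }
  rewrite Heq, Hy0 in H; lra. }
destruct (mvt_open w (fun x => - y x) (1 / 2) 1) as [d [Hd Heq]]; [lra| | |].
{ intros x _; apply Hw. }
{ intros x Hx; apply Hdw; lra. }
assert (Hyd : 0 < y d).
{ assert (0 < w (1 / 2)) by (apply Hwp; lra); rewrite Hw1 in Heq; nra. }
split; try assumption; [|lra].
intros r Hr; apply Rnot_le_lt; intros Hle.
assert (Hneg : y r < 0) by (generalize (Hy_ne r Hr); lra).
destruct (Rtotal_order r d) as [Hlt | [-> |Hgt]]; [|lra|].
- destruct (IVT_interv y r d) as [z [Hz Hz0]]; [intros; apply Hy|lra|lra|lra|].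
  apply (Hy_ne z); [lra|exact Hz0].
- destruct (IVT_interv (fun t => - y t) d r) as [z [Hz Hz0]];
    [|lra|lra|lra|apply (Hy_ne z); lra].
  intros t _; apply (continuity_pt_opp y), Hy.
Qed.

Lemma MO_sol_profile (N : nat) (f : R -> R) (lam : R) (u : R -> R) :
  (1 <= N)%nat -> Nat.Even N -> 0 < lam -> (forall s, 0 < s -> 0 < f s) ->
  MO_sol N f lam u -> negative01 u ->
  exists w y, (forall r, I01 r -> w r = - u r) /\
    profile N (fun r => lam ^ N * f (w r)) w y.
Proof.
intros HN Hev Hlam Hf [u1 [u2 [[HC1 [HC2 _]] [Hode [Hu10 Hu1]]]]] Hneg.
pose (w := fun x => (fun r => - u r) (clamp 0 1 x)).
pose (y := fun x => u1 (clamp 0 1 x)).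
exists w, y; split.
{ intros r Hr; unfold w; rewrite clamp_id; [reflexivity|exact Hr]. }
assert (Hwr : forall r, 0 <= r <= 1 -> w r = - u r).
{ intros r Hr; unfold w; rewrite clamp_id; [reflexivity|exact Hr]. }
assert (Hyr : forall r, 0 <= r <= 1 -> y r = u1 r).
{ intros r Hr; unfold y; rewrite clamp_id; [reflexivity|exact Hr]. }
apply profile_intro; try assumption.
- apply (continuity_opp (fun x => u (clamp 0 1 x))), (continuity_clamp u).
  intros x Hx; eapply deriv_within_cont; [exact Hx|now apply HC1].
- apply (continuity_clamp u1).
  intros x Hx; eapply deriv_within_cont; [exact Hx|now apply HC2].
- intros r Hr; apply (is_derive_clamp (fun s => - u s)); [exact Hr|].
  rewrite Hyr by lra.
  apply (is_derive_opp u), deriv_within_interior; [exact Hr|].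
  apply HC1; unfold I01; lra.
- intros r Hr; rewrite Hwr by lra.
  apply (is_derive_clamp (fun s => u1 s ^ N)); [exact Hr|].
  apply is_derive_Reals.
  replace (INR N * r ^ (N - 1) * (lam ^ N * f (- u r)))
    with (lam ^ N * INR N * r ^ (N - 1) * f (- u r)) by ring.
  now apply Hode.
- rewrite Hyr by lra; exact Hu10.
- rewrite Hwr by lra; lra.
- intros r Hr; rewrite Hwr by lra; generalize (Hneg r Hr); lra.
- intros r Hr; apply Rmult_lt_0_compat; [now apply pow_lt|apply Hf].
  rewrite Hwr by lra; generalize (Hneg r Hr); lra.
Qed.

Lemma pos_eig_profile (N : nat) (lam : R) :
  (1 <= N)%nat -> Nat.Even N -> 0 < lam -> pos_eig N lam ->
  exists v y, v 1 = 0 /\ profile N (fun r => lam ^ N * v r ^ N) v y.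
Proof.
intros HN Hev Hlam [v0 [[v1 [v2 [[HC1 [HC2 _]] [Hode [Hv10 Hv1]]]]] Hpos]].
pose (v := fun x => v0 (clamp 0 1 x)).
pose (y := fun x => (fun r => - v1 r) (clamp 0 1 x)).
assert (Hvr : forall r, 0 <= r <= 1 -> v r = v0 r).
{ intros r Hr; unfold v; rewrite clamp_id; [reflexivity|exact Hr]. }
assert (Hyr : forall r, 0 <= r <= 1 -> y r = - v1 r).
{ intros r Hr; unfold y; rewrite clamp_id; [reflexivity|exact Hr]. }
exists v, y; split; [rewrite Hvr; lra|].
apply profile_intro; try assumption.
- apply (continuity_clamp v0).
  intros x Hx; eapply deriv_within_cont; [exact Hx|now apply HC1].
- apply (continuity_opp (fun x => v1 (clamp 0 1 x))), (continuity_clamp v1).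
  intros x Hx; eapply deriv_within_cont; [exact Hx|now apply HC2].
- intros r Hr; apply (is_derive_clamp v0); [exact Hr|].
  rewrite Hyr, Ropp_involutive by lra.
  apply deriv_within_interior; [exact Hr|].
  apply HC1; unfold I01; lra.
- intros r Hr; rewrite Hvr by lra.
  apply (is_derive_clamp (fun s => (- v1 s) ^ N)); [exact Hr|].
  apply is_derive_Reals.
  replace (INR N * r ^ (N - 1) * (lam ^ N * v0 r ^ N))
    with (lam ^ N * INR N * r ^ (N - 1) * v0 r ^ N) by ring.
  now apply Hode.
- rewrite Hyr by lra; lra.
- rewrite Hvr by lra; lra.
- intros r Hr; rewrite Hvr by lra; apply Hpos; lra.
- intros r Hr; apply Rmult_lt_0_compat; apply pow_lt; [exact Hlam|].
  rewrite Hvr by lra; apply Hpos; lra.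
Qed.

(** * Roots, geometric limits and convexity *)

(* [Rpower 0 p] is [1], so nonpositive arguments need a separate case. *)
Definition nroot (n : nat) (x : R) : R :=
  if Rle_dec x 0 then 0 else Rpower x (/ INR n).

Section Nroot.

Variables (n : nat) (Hn : (1 <= n)%nat).

Lemma nroot_nonneg (x : R) : 0 <= nroot n x.
Proof.
unfold nroot; destruct (Rle_dec x 0); [lra|].
unfold Rpower; apply Rlt_le, exp_pos.
Qed.

Lemma nroot_pos (x : R) : 0 < x -> 0 < nroot n x.
Proof.
intros Hx; unfold nroot; destruct (Rle_dec x 0); [lra|].
unfold Rpower; apply exp_pos.
Qed.

Lemma nroot_pow (x : R) : 0 <= x -> nroot n x ^ n = x.
Proof.
intros Hx; unfold nroot; destruct (Rle_dec x 0).
- rewrite pow_i by lia; lra.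
- rewrite <- Rpower_pow by (unfold Rpower; apply exp_pos).
  rewrite Rpower_mult, Rinv_l; [apply Rpower_1; lra|].
  apply not_0_INR; lia.
Qed.

Lemma nroot_npos (x : R) : x <= 0 -> nroot n x = 0.
Proof. intros Hx; unfold nroot; destruct (Rle_dec x 0); lra. Qed.

Lemma pow_superadditive (a b : R) : 0 <= a -> 0 <= b -> a ^ n + b ^ n <= (a + b) ^ n.
Proof.
intros Ha Hb; induction n as [|[|k] IH]; [lia|simpl; lra|].
assert (IH' : a ^ S k + b ^ S k <= (a + b) ^ S k) by (apply IH; lia).
assert (0 <= a ^ S k) by now apply pow_le.
assert (0 <= b ^ S k) by now apply pow_le.
change (a * a ^ S k + b * b ^ S k <= (a + b) * (a + b) ^ S k); nra.
Qed.

(** Superadditivity of powers makes the root subadditive. The modulus [e ^ n] is uniform and so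
    covers [0] and negative arguments as well. *)
Lemma nroot_le_add (x y e : R) : 0 < e -> y - x < e ^ n -> nroot n y <= nroot n x + e.
Proof.
intros He Hlt.
assert (Hx := nroot_nonneg x).
apply Rnot_lt_le; intros H.
destruct (Rle_dec y 0) as [Hy|Hy]; [rewrite (nroot_npos y Hy) in H; lra|].
assert (H1 := pow_superadditive (nroot n x) e Hx ltac:(lra)).
assert (H2 : (nroot n x + e) ^ n < nroot n y ^ n) by (apply pow_lt_compat; [exact Hn|lra]).
rewrite nroot_pow in H2 by lra.
destruct (Rle_dec x 0) as [Hx0|Hx0].
- rewrite (nroot_npos x Hx0), Rplus_0_l in H2; lra.
- rewrite nroot_pow in H1 by lra; lra.
Qed.

Lemma nroot_continuity : continuity (nroot n).
Proof.
intros x eps Heps.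
exists ((eps / 2) ^ n); split; [apply pow_lt; lra|].
simpl; unfold R_dist; intros t [_ Ht].
assert (H1 := Rle_abs (t - x)).
assert (H2 := Rle_abs (- (t - x))); rewrite Rabs_Ropp in H2.
assert (H3 := nroot_le_add x t (eps / 2) ltac:(lra) ltac:(lra)).
assert (H4 := nroot_le_add t x (eps / 2) ltac:(lra) ltac:(lra)).
apply Rle_lt_trans with (eps / 2); [|lra].
apply Rabs_le; lra.
Qed.

Lemma nroot_derive (x : R) :
  0 < x -> is_derive (nroot n) x (nroot n x / (INR n * x)).
Proof.
intros Hx.
assert (HnR : INR n <> 0) by (apply not_0_INR; lia).
apply (is_derive_ext_loc (fun t => exp (/ INR n * ln t))).
- exists (mkposreal x Hx); intros t Ht.
  unfold ball in Ht; simpl in Ht;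
    unfold AbsRing_ball, abs, minus, plus, opp in Ht; simpl in Ht.
  assert (H2 := Rle_abs (- (t + - x))); rewrite Rabs_Ropp in H2.
  unfold nroot; destruct (Rle_dec t 0); [lra|reflexivity].
- unfold nroot; destruct (Rle_dec x 0); [lra|].
  unfold Rpower; auto_derive; [exact Hx|field; split; [lra|exact HnR]].
Qed.

End Nroot.

Lemma le_geometric_nonpos (x C : R) : (forall n : nat, x <= C / 2 ^ n) -> x <= 0.
Proof.
intros H.
apply (is_lim_seq_le (fun _ => x) (fun n => C * (/ 2) ^ n) x 0).
- intros n; rewrite pow_inv; apply H.
- apply is_lim_seq_const.
- replace 0 with (C * 0) by ring.
  apply (is_lim_seq_scal_l _ C 0), is_lim_seq_geom.
  rewrite Rabs_pos_eq; lra.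
Qed.

Lemma geometric_steps_lim (x : nat -> R) (C : R) :
  (forall n, Rabs (x (S n) - x n) <= C / 2 ^ n) ->
  is_lim_seq x (real (Lim_seq x)) /\
  forall n, Rabs (real (Lim_seq x) - x n) <= 2 * C / 2 ^ n.
Proof.
intros H.
assert (Hp : forall n, 0 < 2 ^ n) by (intros n; apply pow_lt; lra).
assert (HC : 0 <= C).
{ specialize (H 0%nat); generalize (Rabs_pos (x 1%nat - x 0%nat)); simpl in H; lra. }
(* Keeping the remaining tail of the geometric series on the right is what lets the induction on [k]
   close. *)
assert (Hk : forall n k, Rabs (x (n + k)%nat - x n) <= 2 * C / 2 ^ n - 2 * C / 2 ^ (n + k)).
{ intros n k; induction k as [|k IH].
  - rewrite Nat.add_0_r, !Rminus_diag, Rabs_R0; lra.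
  - rewrite Nat.add_succ_r.
    assert (H1 := H (n + k)%nat).
    assert (H2 := Rabs_triang (x (S (n + k)) - x (n + k)%nat) (x (n + k)%nat - x n)).
    replace (x (S (n + k)) - x (n + k)%nat + (x (n + k)%nat - x n))
      with (x (S (n + k)) - x n) in H2 by ring.
    replace (2 * C / 2 ^ S (n + k)) with (C / 2 ^ (n + k))
      by (simpl; field; specialize (Hp (n + k)%nat); lra).
    replace (2 * C / 2 ^ (n + k)) with (2 * (C / 2 ^ (n + k))) in IH
      by (field; specialize (Hp (n + k)%nat); lra).
    lra. }
assert (Hk' : forall n k, Rabs (x (n + k)%nat - x n) <= 2 * C / 2 ^ n).
{ intros n k; assert (0 <= 2 * C / 2 ^ (n + k)); [|specialize (Hk n k); lra].
  apply Rdiv_le_0_compat; [lra|apply Hp]. }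
assert (Hex : ex_finite_lim_seq x).
{ apply ex_lim_seq_cauchy_corr; intros eps.
  assert (HN : exists n, 4 * C / 2 ^ n < eps).
  { destruct (pow_lt_1_zero (/ 2) ltac:(rewrite Rabs_pos_eq; lra) (eps / (4 * C + 1)))
      as [n Hn].
    - apply Rdiv_lt_0_compat; [apply cond_pos|lra].
    - exists n; specialize (Hn n (le_n n)).
      rewrite pow_inv in Hn.
      assert (Hi : 0 < / 2 ^ n) by (apply Rinv_0_lt_compat, Hp).
      rewrite Rabs_pos_eq in Hn by lra.
      apply Rlt_div_r in Hn; [|lra].
      unfold Rdiv; nra. }
  destruct HN as [M HM]; exists M; intros n k Hn Hk2.
  assert (H1 := Hk' M (n - M)%nat).
  assert (H2 := Hk' M (k - M)%nat).
  replace (M + (n - M))%nat with n in H1 by lia.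
  replace (M + (k - M))%nat with k in H2 by lia.
  rewrite Rabs_minus_sym in H2.
  assert (H3 := Rabs_triang (x n - x M) (x M - x k)).
  replace (x n - x M + (x M - x k)) with (x n - x k) in H3 by ring.
  replace (4 * C / 2 ^ M) with (2 * C / 2 ^ M + 2 * C / 2 ^ M) in HM
    by (field; specialize (Hp M); lra).
  lra. }
assert (Hl := Lim_seq_correct' x Hex).
split; [exact Hl|]; intros n.
apply (is_lim_seq_le (fun k => Rabs (x (k + n)%nat - x n)) (fun _ => 2 * C / 2 ^ n)
         (Rabs (real (Lim_seq x) - x n)) (2 * C / 2 ^ n)).
- intros k; rewrite Nat.add_comm; apply Hk'.
- apply (is_lim_seq_abs _ (Finite (real (Lim_seq x) - x n))).
  apply (is_lim_seq_minus' (fun k => x (k + n)%nat) (fun _ => x n)).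
  + apply (is_lim_seq_incr_n x n); exact Hl.
  + apply is_lim_seq_const.
- apply is_lim_seq_const.
Qed.

Lemma RInt_derive (g : R -> R) (r : R) :
  continuity g -> is_derive (fun t => RInt g 0 t) r (g r).
Proof.
intros Hg; apply (is_derive_RInt g (fun t => RInt g 0 t) 0).
- apply filter_forall; intros t; apply (RInt_correct g).
  apply (ex_RInt_continuous g); intros z _; apply continuity_pt_filterlim, Hg.
- apply continuity_pt_filterlim, Hg.
Qed.

Lemma derive_continuity_pt (g : R -> R) (r l : R) : is_derive g r l -> continuity_pt g r.
Proof.
intros H; apply derivable_continuous_pt; exists l; now apply is_derive_Reals.
Qed.

Lemma lipschitz_continuity (g : R -> R) (L : R) :
  (forall r s, Rabs (g r - g s) <= L * Rabs (r - s)) -> continuity g.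
Proof.
intros H x eps Heps.
assert (HL : 0 <= L).
{ specialize (H 1 0); rewrite Rminus_0_r, Rabs_R1 in H.
  generalize (Rabs_pos (g 1 - g 0)); lra. }
exists (eps / (L + 1)); split; [apply Rdiv_lt_0_compat; lra|].
simpl; unfold R_dist; intros t [_ Ht].
apply Rlt_div_r in Ht; [|lra].
specialize (H t x); generalize (Rabs_pos (t - x)); nra.
Qed.

Lemma deriv_within_of_is_derive (D : R -> Prop) (g : R -> R) (x l : R) :
  is_derive g x l -> deriv_within D g x l.
Proof.
intros Hd eps Heps; apply is_derive_Reals in Hd.
destruct (Hd eps Heps) as [d H]; exists d; split; [apply cond_pos|].
simpl; unfold R_dist; intros t [[_ Hne] Ht].
specialize (H (t - x) ltac:(lra) Ht).
now replace (x + (t - x)) with t in H by ring.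
Qed.

Lemma limit1_in_of_continuity_pt (D : R -> Prop) (g : R -> R) (x : R) :
  continuity_pt g x -> limit1_in g D (g x) x.
Proof.
intros Hc eps Heps; destruct (Hc eps Heps) as [d [Hd H]].
exists d; split; [exact Hd|]; simpl in *; unfold R_dist in *.
intros t [_ Ht]; destruct (Req_dec t x) as [-> |Hne].
- rewrite Rminus_diag, Rabs_R0; exact Heps.
- apply H; split; [unfold D_x, no_cond; split; [exact I|lra]|exact Ht].
Qed.

(** * Strict convexity and monotone derivatives *)

Lemma strictly_convex01_of_derive (u u1 : R -> R) :
  (forall x, 0 < x < 1 -> is_derive u x (u1 x)) ->
  (forall x y, 0 < x -> x < y -> y < 1 -> u1 x < u1 y) ->
  strictly_convex01 u.
Proof.
intros Hd Hinc.
assert (Hlt : forall x y t, 0 < x -> x < y -> y < 1 -> 0 < t < 1 ->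
  u (t * x + (1 - t) * y) < t * u x + (1 - t) * u y).
{ intros x y t Hx Hxy Hy Ht.
  set (z := t * x + (1 - t) * y).
  assert (Hz : x < z < y) by (unfold z; nra).
  assert (Hcont : forall s, 0 < s < 1 -> continuity_pt u s).
  { intros s Hs; eapply derive_continuity_pt, Hd, Hs. }
  destruct (mvt_open u u1 x z) as [c [Hc Hceq]]; [lra| | |].
  { intros s Hs; apply Hcont; lra. }
  { intros s Hs; apply Hd; lra. }
  destruct (mvt_open u u1 z y) as [d [Hd' Hdeq]]; [lra| | |].
  { intros s Hs; apply Hcont; lra. }
  { intros s Hs; apply Hd; lra. }
  assert (Hcd := Hinc c d ltac:(lra) ltac:(lra) ltac:(lra)).
  assert (E1 : z - x = (1 - t) * (y - x)) by (unfold z; ring).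
  assert (E2 : y - z = t * (y - x)) by (unfold z; ring).
  rewrite E1 in Hceq; rewrite E2 in Hdeq.
  assert (0 < t * (1 - t) * (y - x)) by (repeat apply Rmult_lt_0_compat; lra).
  assert (Hdiff : t * u x + (1 - t) * u y - u z
              = t * (1 - t) * (y - x) * (u1 d - u1 c)).
  { replace (u x) with (u z - u1 c * ((1 - t) * (y - x))) by lra.
    replace (u y) with (u z + u1 d * (t * (y - x))) by lra.
    ring. }
  assert (0 < t * (1 - t) * (y - x) * (u1 d - u1 c)); [|lra].
  apply Rmult_lt_0_compat; lra. }
intros x y t Hx Hy Hne Ht.
destruct (Rtotal_order x y) as [Hxy | [Heq | Hxy]]; [|contradiction|].
- apply Hlt; lra.
- replace (t * x + (1 - t) * y) with ((1 - t) * y + (1 - (1 - t)) * x) by ring.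
  replace (t * u x + (1 - t) * u y) with ((1 - t) * u y + (1 - (1 - t)) * u x) by ring.
  apply Hlt; lra.
Qed.

(** The chord minus [u] vanishes at both ends and is positive between them, which fixes the sign of
    its derivative at each end. *)
Lemma strictly_convex01_chord (u u1 : R -> R) (x y : R) :
  (forall x, 0 < x < 1 -> is_derive u x (u1 x)) -> strictly_convex01 u ->
  0 < x -> x < y -> y < 1 -> u1 x <= (u y - u x) / (y - x) <= u1 y.
Proof.
intros Hd Hconv Hx Hxy Hy.
set (k := (u y - u x) / (y - x)).
pose (g := fun s => u x + k * (s - x) - u s).
assert (Hgd : forall s, 0 < s < 1 -> is_derive g s (k - u1 s)).
{ intros s Hs; apply (is_derive_minus (fun s => u x + k * (s - x)) u); [|now apply Hd].
  auto_derive; [trivial|ring]. }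
assert (Hgpos : forall s, x < s < y -> 0 < g s).
{ intros s Hs; unfold g.
  set (t := (y - s) / (y - x)).
  assert (Ht : 0 < t < 1).
  { unfold t; split; [apply Rdiv_lt_0_compat; lra|].
    apply Rlt_div_l; lra. }
  assert (H := Hconv x y t ltac:(lra) ltac:(lra) ltac:(lra) Ht).
  replace (t * x + (1 - t) * y) with s in H by (unfold t; field; lra).
  replace (u x + k * (s - x)) with (t * u x + (1 - t) * u y); [lra|].
  unfold t, k; field; lra. }
assert (Hgx : g x = 0) by (unfold g; ring).
assert (Hgy : g y = 0) by (unfold g, k; field; lra).
assert (H1 : 0 <= k - u1 x).
{ apply (derive_nonneg_right g x _ y); [lra|apply Hgd; lra|exact Hgx|exact Hgpos]. }
assert (H2 : k - u1 y <= 0).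
{ apply (derive_nonpos_left g y _ x); [lra|apply Hgd; lra|exact Hgy|exact Hgpos]. }
lra.
Qed.

(** Comparing the chords over the two halves of [[x, y]] restores the strictness that
    [strictly_convex01_chord] loses. *)
Lemma strictly_convex01_derive_incr (u u1 : R -> R) (x y : R) :
  (forall x, 0 < x < 1 -> is_derive u x (u1 x)) -> strictly_convex01 u ->
  0 < x -> x < y -> y < 1 -> u1 x < u1 y.
Proof.
intros Hd Hconv Hx Hxy Hy.
set (m := (x + y) / 2).
assert (Hm : x < m < y) by (unfold m; lra).
assert (H1 := strictly_convex01_chord u u1 x m Hd Hconv ltac:(lra) ltac:(lra) ltac:(lra)).
assert (H2 := strictly_convex01_chord u u1 m y Hd Hconv ltac:(lra) ltac:(lra) ltac:(lra)).
assert (H3 := Hconv x y (1 / 2) ltac:(lra) ltac:(lra) ltac:(lra) ltac:(lra)).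
replace (1 / 2 * x + (1 - 1 / 2) * y) with m in H3 by (unfold m; field).
replace (y - m) with (m - x) in H2 by (unfold m; field).
assert ((u m - u x) / (m - x) < (u y - u m) / (m - x)); [|lra].
apply Rmult_lt_compat_r; [apply Rinv_0_lt_compat|]; lra.
Qed.

(** If [u r >= 0], the mean value theorem up to [u 1 = 0] yields [u1 d <= 0]; as [u1] increases
    strictly, it stays below the negative number [u1 (d / 2)] near [0], against [u1 0 = 0] and
    continuity. Nonexistence of convex solutions thus reduces to negative ones. *)
Lemma strictly_convex01_negative (N : nat) (f : R -> R) (lam : R) (u : R -> R) :
  MO_sol N f lam u -> strictly_convex01 u -> negative01 u.
Proof.
intros [u1 [u2 [[HC1 [HC2 _]] [_ [Hu10 Hu1]]]]] Hconv r Hr.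
assert (Hd : forall x, 0 < x < 1 -> is_derive u x (u1 x)).
{ intros x Hx; apply deriv_within_interior; [exact Hx|apply HC1; unfold I01; lra]. }
apply Rnot_le_lt; intros Hge.
assert (HU : continuity (fun x => u (clamp 0 1 x))).
{ apply (continuity_clamp u); intros x Hx.
  eapply deriv_within_cont; [exact Hx|now apply HC1]. }
destruct (mvt_open (fun x => u (clamp 0 1 x)) u1 r 1) as [d [Hdr Heq]]; [lra| | |].
{ intros x _; apply HU. }
{ intros x Hx; apply is_derive_clamp; [lra|apply Hd; lra]. }
rewrite !clamp_id, Hu1 in Heq by lra.
assert (Hdle : u1 d <= 0) by nra.
assert (Hneg : u1 (d / 2) < 0).
{ apply Rlt_le_trans with (2 := Hdle), (strictly_convex01_derive_incr u); auto; lra. }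
destruct (deriv_within_cont u1 0 (u2 0) ltac:(unfold I01; lra)
  (HC2 0 ltac:(unfold I01; lra)) (- u1 (d / 2)) ltac:(lra)) as [e [He H]].
pose (s := Rmin (e / 2) (d / 4)).
assert (Hs : 0 < s /\ s <= e / 2 /\ s <= d / 4).
{ unfold s, Rmin; destruct (Rle_dec (e / 2) (d / 4)); lra. }
assert (Hsd : u1 s < u1 (d / 2)) by (apply (strictly_convex01_derive_incr u); auto; lra).
specialize (H s); simpl in H; unfold R_dist in H.
rewrite Hu10, !Rminus_0_r, (Rabs_pos_eq s), (Rabs_left (u1 s)) in H by lra.
assert (- u1 s < - u1 (d / 2)); [|lra].
apply H; unfold I01; lra.
Qed.

(** * Shooting *)

Section Shooting.

(** [h] stands for [f] truncated to [[0, B]]; [amin] and [B] are the extreme starting values. [rho]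
    controls slopes from above, and [m] keeps [h] off [0] while a shot stays above [amin / 2]. *)
Variables (N : nat) (h : R -> R) (lam rho Lh m amin B : R).
Hypotheses (HN : (1 <= N)%nat) (Hlam : 0 < lam) (Hrho : 0 < rho) (HLh : 0 < Lh)
  (Hm : 0 < m) (Hamin : 0 < amin).
Hypothesis Hh_nonneg : forall s, 0 <= h s.
Hypothesis Hh_bound : forall s, h s <= rho ^ N.
Hypothesis Hh_lip : forall s t, Rabs (h s - h t) <= Lh * Rabs (s - t).
Hypothesis Hh_low : forall s, amin / 2 <= s <= B -> m <= h s.

(** With [y 0 = 0] the equation integrates to [(y / lam) ^ N = mass w]. Hence [slope w] is
    [y / lam], and on [[0, 1]] a solution with [w 0 = a] is a fixed point of [picard a]. *)
Definition mass (w : R -> R) (t : R) : R :=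
  RInt (fun s => INR N * s ^ (N - 1) * h (w s)) 0 t.

Definition slope (w : R -> R) (t : R) : R := nroot N (mass w t).

(** The clamp freezes the image outside [[0, 1]], so that the Lipschitz bound of [admissible] can
    hold on the whole line. *)
Definition picard (a : R) (w : R -> R) (r : R) : R :=
  a - lam * RInt (slope w) 0 (clamp 0 1 r).

Definition admissible (a : R) (w : R -> R) : Prop :=
  (forall r s, Rabs (w r - w s) <= lam * rho * Rabs (r - s)) /\
  w 0 = a /\ (forall r, w r <= a).

Lemma admissible_cont (a : R) (w : R -> R) : admissible a w -> continuity w.
Proof. intros [H _]; exact (lipschitz_continuity w _ H). Qed.

Lemma density_cont (w : R -> R) :
  continuity w -> continuity (fun s => INR N * s ^ (N - 1) * h (w s)).
Proof.
intros Hw x.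
apply (continuity_pt_mult (fun s => INR N * s ^ (N - 1)) (fun s => h (w s))).
- apply (continuity_pt_scal (fun s => s ^ (N - 1)) (INR N)).
  apply derivable_continuous_pt, derivable_pt_pow.
- apply (continuity_pt_comp w h); [apply Hw|].
  exact (lipschitz_continuity h Lh Hh_lip (w x)).
Qed.

Lemma mass_derive (w : R -> R) (t : R) : continuity w ->
  is_derive (mass w) t (INR N * t ^ (N - 1) * h (w t)).
Proof.
intros Hw.
apply (RInt_derive (fun s => INR N * s ^ (N - 1) * h (w s))), density_cont, Hw.
Qed.

Lemma mass_0 (w : R -> R) : mass w 0 = 0.
Proof. unfold mass; rewrite RInt_point; reflexivity. Qed.

Lemma mass_cont (w : R -> R) : continuity w -> continuity (mass w).
Proof. intros Hw t; eapply derive_continuity_pt, mass_derive, Hw. Qed.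

Lemma scal_pow_derive (k x : R) :
  is_derive (fun s => k * s ^ N) x (INR N * x ^ (N - 1) * k).
Proof.
auto_derive; [trivial|].
replace (Nat.pred N) with (N - 1)%nat by lia; ring.
Qed.

Lemma scal_pow_cont (k : R) : continuity (fun s => k * s ^ N).
Proof. intros x; eapply derive_continuity_pt, scal_pow_derive. Qed.

Lemma density_le (s x y : R) :
  0 < s -> x <= y -> INR N * s ^ (N - 1) * x <= INR N * s ^ (N - 1) * y.
Proof.
intros Hs Hxy; apply Rmult_le_compat_l; [|exact Hxy].
now apply Rlt_le, INR_pow_pos.
Qed.

Lemma mass_le_pow (w : R -> R) (k t : R) :
  continuity w -> 0 <= t -> (forall s, 0 < s < t -> h (w s) <= k) ->
  mass w t <= k * t ^ N.
Proof.
intros Hw Ht Hk.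
assert (H := derive_le_incr (mass w) (fun s => k * s ^ N)
  (fun s => INR N * s ^ (N - 1) * h (w s)) (fun s => INR N * s ^ (N - 1) * k) 0 t Ht).
rewrite mass_0, pow_i in H by lia.
cut (mass w t - 0 <= k * t ^ N - k * 0); [lra|].
apply H.
- intros x _; apply mass_cont, Hw.
- intros x _; apply scal_pow_cont.
- intros x _; apply mass_derive, Hw.
- intros x _; apply scal_pow_derive.
- intros x Hx; apply density_le; [lra|now apply Hk].
Qed.

Lemma mass_ge_pow (w : R -> R) (k t : R) :
  continuity w -> 0 <= t -> (forall s, 0 < s < t -> k <= h (w s)) ->
  k * t ^ N <= mass w t.
Proof.
intros Hw Ht Hk.
assert (H := derive_le_incr (fun s => k * s ^ N) (mass w)
  (fun s => INR N * s ^ (N - 1) * k) (fun s => INR N * s ^ (N - 1) * h (w s)) 0 t Ht).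
rewrite mass_0, pow_i in H by lia.
cut (k * t ^ N - k * 0 <= mass w t - 0); [lra|].
apply H.
- intros x _; apply scal_pow_cont.
- intros x _; apply mass_cont, Hw.
- intros x _; apply scal_pow_derive.
- intros x _; apply mass_derive, Hw.
- intros x Hx; apply density_le; [lra|now apply Hk].
Qed.

Lemma mass_incr (w : R -> R) (s t : R) :
  continuity w -> 0 <= s <= t -> mass w s <= mass w t.
Proof.
intros Hw Hst.
assert (H := derive_le_incr (fun _ => 0) (mass w) (fun _ => 0)
  (fun s => INR N * s ^ (N - 1) * h (w s)) s t (proj2 Hst)).
cut (0 - 0 <= mass w t - mass w s); [lra|].
apply H.
- intros x _; apply continuity_pt_const; intros ? ?; reflexivity.
- intros x _; apply mass_cont, Hw.
- intros x _; apply (is_derive_const 0).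
- intros x _; apply mass_derive, Hw.
- intros x Hx; apply Rmult_le_pos; [|apply Hh_nonneg].
  apply Rlt_le, INR_pow_pos; [exact HN|lra].
Qed.

Lemma mass_nonneg (w : R -> R) (t : R) : continuity w -> 0 <= t -> 0 <= mass w t.
Proof. intros Hw Ht; rewrite <- (mass_0 w); apply mass_incr; [exact Hw|lra]. Qed.

Lemma slope_pow (w : R -> R) (t : R) :
  continuity w -> 0 <= t -> slope w t ^ N = mass w t.
Proof. intros Hw Ht; apply nroot_pow; [exact HN|now apply mass_nonneg]. Qed.

Lemma slope_nonneg (w : R -> R) (t : R) : 0 <= slope w t.
Proof. apply nroot_nonneg. Qed.

Lemma slope_cont (w : R -> R) : continuity w -> continuity (slope w).
Proof.
intros Hw t; apply (continuity_pt_comp (mass w) (nroot N)).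
- now apply mass_cont.
- now apply nroot_continuity.
Qed.

Lemma slope_0 (w : R -> R) : slope w 0 = 0.
Proof. unfold slope; rewrite mass_0; apply nroot_npos; lra. Qed.

Lemma slope_upper (w : R -> R) (t : R) : continuity w -> 0 <= t -> slope w t <= rho * t.
Proof.
intros Hw Ht; apply (pow_le_reg N); [exact HN|nra|].
rewrite slope_pow, Rpow_mult_distr by assumption.
apply mass_le_pow; auto.
Qed.

(* An admissible [w] stays above [amin / 2] up to time [t0], which keeps
   [slope w t] away from [0] linearly on all of [[0, 1]]. *)
Definition t0 : R := Rmin 1 (amin / (2 * (lam * rho))).
Definition kappa : R := nroot N m * t0.

Lemma t0_spec : 0 < t0 /\ t0 <= 1 /\ lam * rho * t0 <= amin / 2.
Proof.
assert (Hlr : 0 < lam * rho) by nra.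
assert (Hq : 0 < amin / (2 * (lam * rho))) by (apply Rdiv_lt_0_compat; lra).
unfold t0; split; [apply Rmin_pos; lra|split; [apply Rmin_l|]].
apply Rle_trans with (lam * rho * (amin / (2 * (lam * rho)))).
- apply Rmult_le_compat_l; [lra|apply Rmin_r].
- right; field; split; lra.
Qed.

Lemma kappa_pos : 0 < kappa.
Proof.
apply Rmult_lt_0_compat; [now apply nroot_pos|apply t0_spec].
Qed.

Lemma slope_lower (a : R) (w : R -> R) (t : R) :
  admissible a w -> amin <= a <= B -> 0 <= t <= 1 -> kappa * t <= slope w t.
Proof.
intros Hadm Ha Ht; assert (Hw := admissible_cont a w Hadm).
destruct Hadm as [Hlip [Hw0 Hle]].
destruct t0_spec as [Ht0 [Ht01 Ht0a]].
assert (Hlow : forall s, 0 <= s <= t0 -> m * s ^ N <= mass w s).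
{ intros s Hs; apply mass_ge_pow; [exact Hw|lra|]; intros x Hx; apply Hh_low.
  specialize (Hlip 0 x); rewrite Hw0 in Hlip; specialize (Hle x).
  replace (0 - x) with (- x) in Hlip by ring.
  rewrite Rabs_Ropp, (Rabs_pos_eq x) in Hlip by lra.
  assert (lam * rho * x <= lam * rho * t0) by (apply Rmult_le_compat_l; nra).
  generalize (Rle_abs (a - w x)); lra. }
apply (pow_le_reg N); [exact HN|apply slope_nonneg|].
rewrite slope_pow by (assumption || lra).
unfold kappa; rewrite !Rpow_mult_distr, nroot_pow by (assumption || lra).
assert (Htn : 0 <= t ^ N <= 1).
{ split; [apply pow_le; lra|rewrite <- (pow1 N); apply pow_incr; lra]. }
assert (Ht0n : 0 < t0 ^ N <= 1).
{ split; [now apply pow_lt|rewrite <- (pow1 N); apply pow_incr; lra]. }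
destruct (Rle_lt_dec t t0) as [Hle'|Hlt].
- apply Rle_trans with (m * t ^ N); [|apply Hlow; lra].
  rewrite Rmult_assoc; apply Rmult_le_compat_l; [lra|nra].
(* Past [t0] monotonicity of the mass suffices, because [t <= 1] gives
   [(kappa * t) ^ N <= m * t0 ^ N]. *)
- apply Rle_trans with (m * t0 ^ N).
  + rewrite Rmult_assoc; apply Rmult_le_compat_l; [lra|nra].
  + apply Rle_trans with (mass w t0); [apply Hlow; lra|].
    apply mass_incr; [exact Hw|lra].
Qed.

Lemma slope_int_derive (w : R -> R) (t : R) :
  continuity w -> is_derive (fun r => RInt (slope w) 0 r) t (slope w t).
Proof. intros Hw; now apply (RInt_derive (slope w)), slope_cont. Qed.

Lemma slope_int_cont (w : R -> R) :
  continuity w -> continuity (fun r => RInt (slope w) 0 r).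
Proof. intros Hw t; eapply derive_continuity_pt, slope_int_derive, Hw. Qed.

Lemma slope_int_bounds (w : R -> R) (r s : R) :
  continuity w -> 0 <= r -> r <= s -> s <= 1 ->
  0 <= RInt (slope w) 0 s - RInt (slope w) 0 r <= rho * (s - r).
Proof.
intros Hw Hr [Hrs | ->] Hs; [|lra].
destruct (mvt_open (fun r => RInt (slope w) 0 r) (slope w) r s Hrs) as [c [Hc Heq]].
- intros x _; now apply slope_int_cont.
- intros x _; now apply slope_int_derive.
- assert (H1 := slope_nonneg w c).
  assert (H2 := slope_upper w c Hw ltac:(lra)).
  assert (H3 : rho * c <= rho) by nra.
  rewrite Heq; split; [apply Rmult_le_pos|apply Rmult_le_compat_r]; lra.
Qed.

Lemma picard_admissible (a b : R) (w : R -> R) :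
  admissible b w -> admissible a (picard a w).
Proof.
intros Hadm; assert (Hw := admissible_cont b w Hadm).
assert (H0 : RInt (slope w) 0 0 = 0) by (rewrite RInt_point; reflexivity).
assert (Hmon : forall r s, clamp 0 1 r <= clamp 0 1 s ->
  Rabs (picard a w r - picard a w s) <= lam * rho * Rabs (r - s)).
{ intros r s Hrs.
  assert (Hr := clamp_in 0 1 r ltac:(lra)).
  assert (Hs := clamp_in 0 1 s ltac:(lra)).
  assert (Hb := slope_int_bounds w (clamp 0 1 r) (clamp 0 1 s) Hw ltac:(lra) Hrs ltac:(lra)).
  assert (Hl := clamp_lipschitz 0 1 r s ltac:(lra)).
  rewrite (Rabs_minus_sym (clamp 0 1 r)), Rabs_pos_eq in Hl by lra.
  unfold picard.
  match goal with |- Rabs ?x <= _ => replace x with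
    (lam * (RInt (slope w) 0 (clamp 0 1 s) - RInt (slope w) 0 (clamp 0 1 r))) by ring end.
  rewrite Rabs_pos_eq by (apply Rmult_le_pos; lra).
  rewrite Rmult_assoc; apply Rmult_le_compat_l; [lra|].
  apply Rle_trans with (1 := proj2 Hb), Rmult_le_compat_l; lra. }
split; [|split].
- intros r s; destruct (Rle_lt_dec (clamp 0 1 r) (clamp 0 1 s)).
  + now apply Hmon.
  + rewrite Rabs_minus_sym, (Rabs_minus_sym r); apply Hmon; lra.
- unfold picard; rewrite clamp_id, H0 by lra; ring.
- intros r; unfold picard.
  assert (Hr := clamp_in 0 1 r ltac:(lra)).
  assert (Hb := slope_int_bounds w 0 (clamp 0 1 r) Hw ltac:(lra) ltac:(lra) ltac:(lra)).
  nra.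
Qed.

(** * Contraction in the weighted norm *)

Definition slope_lip : R := Lh / kappa ^ (N - 1).
(** Chosen so that [lam * slope_lip] times the integral of [exp (rate * s)] over [[0, r]] is at most
    [exp (rate * r) / 2], which gives the contraction factor [1 / 2]. *)
Definition rate : R := 2 * lam * slope_lip.

Lemma slope_lip_pos : 0 < slope_lip.
Proof. apply Rdiv_lt_0_compat; [exact HLh|apply pow_lt, kappa_pos]. Qed.

Lemma rate_pos : 0 < rate.
Proof. unfold rate; generalize slope_lip_pos; nra. Qed.

Lemma exp_rate_ge_1 (r : R) : 0 <= r -> 1 <= exp (rate * r).
Proof.
intros Hr; assert (0 <= rate * r) by (generalize rate_pos; nra).
generalize (exp_ineq1_le (rate * r)); lra.
Qed.

Lemma exp_rate_le (r s : R) : r <= s -> exp (rate * r) <= exp (rate * s).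
Proof.
intros [Hrs | ->]; [|lra].
apply Rlt_le, exp_increasing, Rmult_lt_compat_l; [apply rate_pos|exact Hrs].
Qed.

(** The weight increases, so on [[0, t]] it is bounded by its value at [t]; the rest integrates to
    [t ^ N], the power consumed in [slope_diff]. *)
Lemma mass_diff (w v : R -> R) (D t : R) :
  continuity w -> continuity v -> 0 <= D -> 0 <= t <= 1 ->
  (forall r, 0 <= r <= 1 -> Rabs (w r - v r) <= D * exp (rate * r)) ->
  mass w t - mass v t <= Lh * D * exp (rate * t) * t ^ N.
Proof.
intros Hw Hv HD Ht Hwv.
set (k := Lh * D * exp (rate * t)).
assert (H := derive_le_incr (mass w) (fun s => mass v s + k * s ^ N)
  (fun s => INR N * s ^ (N - 1) * h (w s))
  (fun s => INR N * s ^ (N - 1) * h (v s) + INR N * s ^ (N - 1) * k) 0 t ltac:(lra)).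
rewrite !mass_0, pow_i in H by lia.
cut (mass w t - 0 <= mass v t + k * t ^ N - (0 + k * 0)); [lra|].
apply H.
- intros x _; now apply mass_cont.
- intros x _; apply (continuity_pt_plus (mass v) (fun s => k * s ^ N)).
  + now apply mass_cont.
  + apply scal_pow_cont.
- intros x _; now apply mass_derive.
- intros x _; apply (is_derive_plus (mass v) (fun s => k * s ^ N)).
  + now apply mass_derive.
  + apply scal_pow_derive.
- intros x Hx; rewrite <- Rmult_plus_distr_l; apply density_le; [lra|].
  assert (H1 := Hh_lip (w x) (v x)).
  assert (H2 := Hwv x ltac:(lra)).
  assert (H3 := exp_rate_le x t ltac:(lra)).
  assert (H4 := Rle_abs (h (w x) - h (v x))).
  assert (D * exp (rate * x) <= D * exp (rate * t)) by nra.
  assert (Lh * Rabs (w x - v x) <= k).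
  { unfold k; rewrite Rmult_assoc; apply Rmult_le_compat_l; lra. }
  lra.
Qed.

(** Taking roots costs a division by [(kappa * t) ^ (N - 1)], and the [t ^ N] of [mass_diff] pays
    for it. Only the smaller slope, that of [v], needs the linear lower bound, hence a range
    condition on [b] alone. *)
Lemma slope_diff (a b : R) (w v : R -> R) (D t : R) :
  admissible a w -> admissible b v -> amin <= b <= B ->
  0 <= D -> 0 <= t <= 1 ->
  (forall r, 0 <= r <= 1 -> Rabs (w r - v r) <= D * exp (rate * r)) ->
  slope w t - slope v t <= slope_lip * D * exp (rate * t).
Proof.
intros Hadw Hadv Hb HD Ht Hwv.
assert (Hw := admissible_cont a w Hadw).
assert (Hv := admissible_cont b v Hadv).
assert (Hk := kappa_pos).
assert (He := exp_pos (rate * t)).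
assert (Hrhs : 0 <= slope_lip * D * exp (rate * t)).
{ generalize slope_lip_pos; intros; apply Rmult_le_pos; nra. }
destruct (Req_dec t 0) as [-> |Htne]; [rewrite !slope_0; lra|].
destruct (Rle_lt_dec (slope w t) (slope v t)) as [|Hlt]; [lra|].
assert (Hlow := slope_lower b v t Hadv Hb Ht).
assert (Hmd := mass_diff w v D t Hw Hv HD Ht Hwv).
rewrite <- !slope_pow in Hmd by (assumption || lra).
set (x := slope w t) in *; set (y := slope v t) in *.
assert (HS : N = S (N - 1)) by lia.
assert (Hkt : 0 < kappa * t) by (apply Rmult_lt_0_compat; lra).
assert (Hpk : 0 < kappa ^ (N - 1)) by now apply pow_lt.
assert (Hpt : 0 < t ^ (N - 1)) by (apply pow_lt; lra).
(* In [x * x ^ (N - 1) - y * y ^ (N - 1)] the first power is replaced by the smaller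
   [y ^ (N - 1)]. *)
assert (H1 : (x - y) * y ^ (N - 1) <= x ^ N - y ^ N).
{ rewrite HS at 2 3; simpl.
  assert (y ^ (N - 1) <= x ^ (N - 1)) by (apply pow_incr; lra).
  nra. }
assert (H2 : (kappa * t) ^ (N - 1) <= y ^ (N - 1)) by (apply pow_incr; lra).
rewrite Rpow_mult_distr in H2.
assert (H3 : (x - y) * (kappa ^ (N - 1) * t ^ (N - 1))
             <= Lh * D * exp (rate * t) * (t * t ^ (N - 1))).
{ replace (t * t ^ (N - 1)) with (t ^ N) by (rewrite HS at 1; reflexivity).
  apply Rle_trans with ((x - y) * y ^ (N - 1)); [|lra].
  apply Rmult_le_compat_l; lra. }
assert (H4 : (x - y) * kappa ^ (N - 1) <= Lh * D * exp (rate * t) * t).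
{ apply Rmult_le_reg_r with (t ^ (N - 1)); lra. }
assert (H5 : (x - y) * kappa ^ (N - 1) <= Lh * D * exp (rate * t)).
{ assert (0 <= Lh * D * exp (rate * t)) by (repeat apply Rmult_le_pos; lra). nra. }
unfold slope_lip.
replace (Lh / kappa ^ (N - 1) * D * exp (rate * t))
  with (Lh * D * exp (rate * t) / kappa ^ (N - 1)) by (field; lra).
apply Rle_div_r; lra.
Qed.

Lemma slope_int_diff (a b : R) (w v : R -> R) (D r : R) :
  admissible a w -> admissible b v -> amin <= b <= B ->
  0 <= D -> 0 <= r <= 1 ->
  (forall r, 0 <= r <= 1 -> Rabs (w r - v r) <= D * exp (rate * r)) ->
  lam * (RInt (slope w) 0 r - RInt (slope v) 0 r) <= D / 2 * exp (rate * r).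
Proof.
intros Hadw Hadv Hb HD Hr Hwv.
assert (Hw := admissible_cont a w Hadw).
assert (Hv := admissible_cont b v Hadv).
assert (HK := rate_pos).
(* A primitive of the bound in [slope_diff], since [rate / (2 * lam) = slope_lip]; its value at [0]
   is nonnegative and can be discarded. *)
set (E := fun s => D / (2 * lam) * exp (rate * s)).
assert (HE : forall s, is_derive E s (slope_lip * D * exp (rate * s))).
{ intros s; unfold E; auto_derive; [trivial|]. unfold rate; field; lra. }
assert (H := derive_le_incr (fun r => RInt (slope w) 0 r)
  (fun r => RInt (slope v) 0 r + E r)
  (slope w) (fun s => slope v s + slope_lip * D * exp (rate * s)) 0 r ltac:(lra)).
cbv beta in H; rewrite !RInt_point in H.
assert (HE0 : 0 <= E 0).
{ unfold E; apply Rmult_le_pos; [apply Rdiv_le_0_compat; lra|apply Rlt_le, exp_pos]. }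
assert (H' : RInt (slope w) 0 r - RInt (slope v) 0 r <= E r).
{ cut (RInt (slope w) 0 r - 0 <= RInt (slope v) 0 r + E r - (0 + E 0)); [lra|].
  apply H.
  - intros x _; now apply slope_int_cont.
  - intros x _; apply (continuity_pt_plus (fun r => RInt (slope v) 0 r) E).
    + now apply slope_int_cont.
    + eapply derive_continuity_pt, HE.
  - intros x _; now apply slope_int_derive.
  - intros x _; apply (is_derive_plus (fun r => RInt (slope v) 0 r) E).
    + now apply slope_int_derive.
    + apply HE.
  - intros x Hx.
    assert (Hs := slope_diff a b w v D x Hadw Hadv Hb HD ltac:(lra) Hwv); lra. }
replace (D / 2 * exp (rate * r)) with (lam * E r) by (unfold E; field; lra).
apply Rmult_le_compat_l; lra.
Qed.

(** Two starting values are allowed so that one estimate serves the convergence of the iterates, the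
    fixed point equation and the dependence on [a]. *)
Lemma picard_contract (a b : R) (w v : R -> R) (D r : R) :
  admissible a w -> admissible b v -> amin <= a <= B -> amin <= b <= B ->
  0 <= D -> 0 <= r <= 1 ->
  (forall r, 0 <= r <= 1 -> Rabs (w r - v r) <= D * exp (rate * r)) ->
  Rabs (picard a w r - picard b v r) <= Rabs (a - b) + D / 2 * exp (rate * r).
Proof.
intros Hadw Hadv Ha Hb HD Hr Hwv.
assert (H1 := slope_int_diff a b w v D r Hadw Hadv Hb HD Hr Hwv).
assert (Hvw : forall r, 0 <= r <= 1 -> Rabs (v r - w r) <= D * exp (rate * r)).
{ intros s Hs; rewrite Rabs_minus_sym; now apply Hwv. }
assert (H2 := slope_int_diff b a v w D r Hadv Hadw Ha HD Hr Hvw).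
unfold picard; rewrite clamp_id by lra.
match goal with |- Rabs ?x <= _ => replace x with
  ((a - b) + lam * (RInt (slope v) 0 r - RInt (slope w) 0 r)) by ring end.
apply Rle_trans with (1 := Rabs_triang _ _).
apply Rplus_le_compat_l, Rabs_le; lra.
Qed.

(** * Picard iterates and the shooting map *)

Definition picard_iter (a : R) (n : nat) : R -> R :=
  Nat.iter n (picard a) (fun _ => a).

Definition shoot (a r : R) : R := real (Lim_seq (fun n => picard_iter a n r)).

Lemma picard_iter_admissible (a : R) (n : nat) : admissible a (picard_iter a n).
Proof.
induction n as [|n IH].
- split; [|split; [reflexivity|intros; simpl; lra]].
  intros r s; simpl; rewrite Rminus_diag, Rabs_R0.
  apply Rmult_le_pos; [nra|apply Rabs_pos].
- exact (picard_admissible a a _ IH).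
Qed.

Lemma picard_iter_step (a : R) (n : nat) (r : R) :
  amin <= a <= B -> 0 <= r <= 1 ->
  Rabs (picard_iter a (S n) r - picard_iter a n r)
    <= lam * rho / 2 ^ n * exp (rate * r).
Proof.
intros Ha; revert r; induction n as [|n IH]; intros r Hr.
- destruct (picard_iter_admissible a 1) as [Hlip [H0 _]].
  specialize (Hlip r 0); rewrite H0, Rminus_0_r, (Rabs_pos_eq r) in Hlip by lra.
  change (picard_iter a 0 r) with a.
  assert (H := exp_rate_ge_1 r ltac:(lra)).
  assert (0 < lam * rho) by nra.
  simpl (2 ^ 0); unfold Rdiv; rewrite Rinv_1, Rmult_1_r.
  apply Rle_trans with (1 := Hlip); apply Rmult_le_compat_l; lra.
- assert (Hp : 0 < 2 ^ n) by (apply pow_lt; lra).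
  assert (0 < lam * rho) by nra.
  assert (H1 := picard_contract a a (picard_iter a (S n)) (picard_iter a n)
    (lam * rho / 2 ^ n) r (picard_iter_admissible a _) (picard_iter_admissible a _)
    Ha Ha ltac:(apply Rdiv_le_0_compat; lra) Hr IH).
  rewrite Rminus_diag, Rabs_R0, Rplus_0_l in H1.
  replace (lam * rho / 2 ^ S n) with (lam * rho / 2 ^ n / 2) by (simpl; field; lra).
  exact H1.
Qed.

Lemma picard_iter_clamp (a : R) (n : nat) (r : R) :
  picard_iter a n r = picard_iter a n (clamp 0 1 r).
Proof.
destruct n as [|n]; [reflexivity|]; simpl; unfold picard.
rewrite (clamp_id 0 1 (clamp 0 1 r)); [reflexivity|apply clamp_in; lra].
Qed.

Lemma shoot_lim (a r : R) : amin <= a <= B ->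
  is_lim_seq (fun n => picard_iter a n r) (shoot a r) /\
  forall n, Rabs (shoot a r - picard_iter a n r)
              <= 2 * (lam * rho * exp rate) / 2 ^ n.
Proof.
intros Ha; apply geometric_steps_lim; intros n.
rewrite (picard_iter_clamp a (S n)), (picard_iter_clamp a n).
assert (Hr := clamp_in 0 1 r ltac:(lra)).
assert (H := picard_iter_step a n _ Ha Hr).
apply Rle_trans with (1 := H).
assert (Hp : 0 < 2 ^ n) by (apply pow_lt; lra).
replace (lam * rho * exp rate / 2 ^ n) with (lam * rho / 2 ^ n * exp rate)
  by (field; lra).
apply Rmult_le_compat_l; [apply Rdiv_le_0_compat; nra|].
rewrite <- (Rmult_1_r rate) at 2; apply exp_rate_le; lra.
Qed.

Lemma shoot_admissible (a : R) : amin <= a <= B -> admissible a (shoot a).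
Proof.
intros Ha; split; [|split].
- intros r s.
  apply (is_lim_seq_le (fun n => Rabs (picard_iter a n r - picard_iter a n s))
    (fun _ => lam * rho * Rabs (r - s))
    (Rabs (shoot a r - shoot a s)) (lam * rho * Rabs (r - s))).
  + intros n; apply (picard_iter_admissible a n).
  + apply (is_lim_seq_abs _ (Finite (shoot a r - shoot a s))).
    apply is_lim_seq_minus'; now apply shoot_lim.
  + apply is_lim_seq_const.
- unfold shoot; rewrite (Lim_seq_ext _ (fun _ => a)).
  + now rewrite Lim_seq_const.
  + intros n; apply (picard_iter_admissible a n).
- intros r; apply (is_lim_seq_le (fun n => picard_iter a n r) (fun _ => a) (shoot a r) a).
  + intros n; apply (picard_iter_admissible a n).
  + now apply shoot_lim.
  + apply is_lim_seq_const.
Qed.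

(** No limit is taken under the integral: the contraction puts [picard a (shoot a)] within a
    multiple of [1 / 2 ^ n] of the next iterate, which is itself that close to [shoot a]. *)
Lemma shoot_fixed (a r : R) :
  amin <= a <= B -> 0 <= r <= 1 -> shoot a r = picard a (shoot a) r.
Proof.
intros Ha Hr.
cut (Rabs (picard a (shoot a) r - shoot a r) <= 0).
{ intros H.
  assert (H' : Rabs (picard a (shoot a) r - shoot a r) = 0)
    by (generalize (Rabs_pos (picard a (shoot a) r - shoot a r)); lra).
  destruct (Req_dec (picard a (shoot a) r - shoot a r) 0) as [|Hne]; [lra|].
  exfalso; exact (Rabs_no_R0 _ Hne H'). }
set (C := 2 * (lam * rho * exp rate)).
assert (HC : 0 < C).
{ unfold C; generalize (exp_pos rate); intros; repeat apply Rmult_lt_0_compat; lra. }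
apply (le_geometric_nonpos _ (C * exp (rate * r))); intros n.
assert (Hp : 0 < 2 ^ n) by (apply pow_lt; lra).
assert (HD : 0 <= C / 2 ^ n) by (apply Rdiv_le_0_compat; lra).
assert (H1 := picard_contract a a (shoot a) (picard_iter a n) (C / 2 ^ n) r
  (shoot_admissible a Ha) (picard_iter_admissible a n) Ha Ha HD Hr).
rewrite Rminus_diag, Rabs_R0, Rplus_0_l in H1.
assert (H2 : Rabs (picard a (shoot a) r - picard_iter a (S n) r)
             <= C / 2 ^ n / 2 * exp (rate * r)).
{ apply H1; intros s Hs.
  destruct (shoot_lim a s Ha) as [_ H]; specialize (H n); fold C in H.
  assert (He := exp_rate_ge_1 s ltac:(lra)).
  nra. }
destruct (shoot_lim a r Ha) as [_ H3]; specialize (H3 (S n)); fold C in H3.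
rewrite Rabs_minus_sym in H3.
assert (He := exp_rate_ge_1 r ltac:(lra)).
assert (H4 := Rabs_triang (picard a (shoot a) r - picard_iter a (S n) r)
                (picard_iter a (S n) r - shoot a r)).
match type of H4 with Rabs ?x <= _ =>
  replace x with (picard a (shoot a) r - shoot a r) in H4 by ring end.
replace (C / 2 ^ S n) with (C / 2 ^ n / 2) in H3 by (simpl; field; lra).
replace (C * exp (rate * r) / 2 ^ n) with (C / 2 ^ n * exp (rate * r)) by (field; lra).
nra.
Qed.

(** A weighted distance [X] of two fixed points satisfies [X <= Rabs (a - b) + X / 2]. Instead of a
    supremum norm, this inequality is iterated from a crude bound. *)
Lemma shoot_lipschitz (a b r : R) :
  amin <= a <= B -> amin <= b <= B -> 0 <= r <= 1 ->
  Rabs (shoot a r - shoot b r) <= 2 * Rabs (a - b) * exp (rate * r).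
Proof.
intros Ha Hb Hr.
(* Each of the two shots moves by at most [lam * rho] on [[0, 1]], which starts the induction. *)
set (D0 := 2 * (lam * rho)).
assert (HD0 : 0 < D0) by (unfold D0; nra).
assert (Hab := Rabs_pos (a - b)).
assert (Hn : forall n r, 0 <= r <= 1 ->
  Rabs (shoot a r - shoot b r) <= (2 * Rabs (a - b) + D0 / 2 ^ n) * exp (rate * r)).
{ induction n as [|n IH]; intros s Hs; assert (He := exp_rate_ge_1 s ltac:(lra)).
  - destruct (shoot_admissible a Ha) as [La [A0 _]].
    destruct (shoot_admissible b Hb) as [Lb [B0 _]].
    specialize (La s 0); specialize (Lb 0 s).
    rewrite A0, Rminus_0_r, (Rabs_pos_eq s) in La by lra.
    rewrite B0, (Rabs_minus_sym 0), Rminus_0_r in Lb.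
    rewrite (Rabs_pos_eq s) in Lb by lra.
    assert (H1 := Rabs_triang (shoot a s - a) (a - b)).
    assert (H2 := Rabs_triang (shoot a s - a + (a - b)) (b - shoot b s)).
    match type of H2 with Rabs ?x <= _ =>
      replace x with (shoot a s - shoot b s) in H2 by ring end.
    simpl (2 ^ 0); unfold Rdiv; rewrite Rinv_1, Rmult_1_r.
    assert (Hlr : 0 < lam * rho) by now apply Rmult_lt_0_compat.
    assert (lam * rho * s <= lam * rho) by nra.
    apply Rle_trans with (2 * Rabs (a - b) + D0); [unfold D0; lra|].
    rewrite <- (Rmult_1_r (_ + D0)) at 1; apply Rmult_le_compat_l; lra.
  - assert (Hp : 0 < 2 ^ n) by (apply pow_lt; lra).
    assert (HD : 0 <= D0 / 2 ^ n) by (apply Rdiv_le_0_compat; lra).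
    rewrite (shoot_fixed a), (shoot_fixed b) by assumption.
    assert (H1 := picard_contract a b (shoot a) (shoot b)
      (2 * Rabs (a - b) + D0 / 2 ^ n) s (shoot_admissible a Ha) (shoot_admissible b Hb)
      Ha Hb ltac:(lra) Hs IH).
    replace (D0 / 2 ^ S n) with (D0 / 2 ^ n / 2) by (simpl; field; lra).
    nra. }
cut (Rabs (shoot a r - shoot b r) - 2 * Rabs (a - b) * exp (rate * r) <= 0); [lra|].
apply (le_geometric_nonpos _ (D0 * exp (rate * r))); intros n.
specialize (Hn n r Hr).
replace (D0 * exp (rate * r) / 2 ^ n) with (D0 / 2 ^ n * exp (rate * r))
  by (field; apply pow_nonzero; lra).
lra.
Qed.

Lemma shoot_zero :
  amin < B -> shoot amin 1 < 0 -> 0 < shoot B 1 ->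
  exists a, amin <= a <= B /\ shoot a 1 = 0.
Proof.
intros HaB Hneg Hpos.
destruct (IVT_interv (fun a => shoot (clamp amin B a) 1) amin B) as [a [Ha Hza]].
- intros a _.
  apply (lipschitz_continuity (fun a => shoot (clamp amin B a) 1) (2 * exp (rate * 1))).
  intros r s.
  assert (H := shoot_lipschitz (clamp amin B r) (clamp amin B s) 1
    ltac:(apply clamp_in; lra) ltac:(apply clamp_in; lra) ltac:(lra)).
  assert (Hc := clamp_lipschitz amin B r s ltac:(lra)).
  assert (He := exp_pos (rate * 1)).
  nra.
- exact HaB.
- rewrite clamp_id; lra.
- rewrite clamp_id; lra.
- exists a; rewrite clamp_id in Hza by lra; split; [lra|exact Hza].
Qed.

(** * A shot as a classical solution *)

Section Shot.

Variables (a : R) (Ha : amin <= a <= B).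
Hypothesis Hh_pos : forall s, 0 < s -> 0 < h s.
(** An inequality rather than an equation, to cover both the zero of the shooting map and the shot
    from [amin] that is to be refuted. *)
Hypothesis Hshoot1 : 0 <= shoot a 1.

Let w : R -> R := shoot a.

Let w_cont : continuity w.
Proof. exact (admissible_cont a w (shoot_admissible a Ha)). Qed.

Lemma shot_eq (r : R) : 0 <= r <= 1 -> w r = a - lam * RInt (slope w) 0 r.
Proof.
intros Hr; unfold w; rewrite shoot_fixed at 1 by assumption.
unfold picard; now rewrite clamp_id.
Qed.

Lemma shot_int_derive (r : R) :
  is_derive (fun s => a - lam * RInt (slope w) 0 s) r (- (lam * slope w r)).
Proof.
evar_last.
- apply (is_derive_minus (fun _ => a) (fun s => lam * RInt (slope w) 0 s)).
  + apply is_derive_const.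
  + apply (is_derive_scal (fun s => RInt (slope w) 0 s)), slope_int_derive, w_cont.
- unfold minus, plus, opp, zero; simpl; ring.
Qed.

Lemma shot_slope_pos (r : R) : 0 < r <= 1 -> 0 < slope w r.
Proof.
intros Hr.
assert (H := slope_lower a w r (shoot_admissible a Ha) Ha ltac:(lra)).
generalize kappa_pos; nra.
Qed.

Lemma shot_pos (r : R) : 0 <= r < 1 -> 0 < w r.
Proof.
intros Hr; apply Rle_lt_trans with (1 := Hshoot1); fold w.
rewrite !shot_eq by lra.
destruct (mvt_open (fun s => a - lam * RInt (slope w) 0 s)
  (fun s => - (lam * slope w s)) r 1 ltac:(lra)) as [c [Hc Heq]].
- intros x _; eapply derive_continuity_pt, shot_int_derive.
- intros x _; apply shot_int_derive.
- assert (0 < lam * slope w c).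
  { apply Rmult_lt_0_compat; [exact Hlam|apply shot_slope_pos; lra]. }
  nra.
Qed.

Lemma shot_pow_derive (r : R) : 0 < r ->
  is_derive (fun s => (lam * slope w s) ^ N) r
    (INR N * r ^ (N - 1) * (lam ^ N * h (w r))).
Proof.
intros Hr.
apply (is_derive_ext_loc (fun s => lam ^ N * mass w s)).
- exists (mkposreal r Hr); intros t Ht.
  unfold ball in Ht; simpl in Ht;
    unfold AbsRing_ball, abs, minus, plus, opp in Ht; simpl in Ht.
  assert (H2 := Rle_abs (- (t + - r))); rewrite Rabs_Ropp in H2.
  rewrite Rpow_mult_distr, slope_pow; [reflexivity|exact w_cont|lra].
- replace (INR N * r ^ (N - 1) * (lam ^ N * h (w r)))
    with (lam ^ N * (INR N * r ^ (N - 1) * h (w r))) by ring.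
  apply (is_derive_scal (mass w)), mass_derive, w_cont.
Qed.

Lemma shot_profile :
  profile N (fun r => lam ^ N * h (shoot a r)) (shoot a) (fun r => lam * slope (shoot a) r).
Proof.
fold w; split.
- exact w_cont.
- apply (continuity_scal (slope w)), slope_cont, w_cont.
- intros r Hr.
  apply (is_derive_ext_loc (fun s => a - lam * RInt (slope w) 0 s)).
  + assert (He : 0 < Rmin r (1 - r)) by (apply Rmin_pos; lra).
    exists (mkposreal _ He); intros t Ht.
    unfold ball in Ht; simpl in Ht;
      unfold AbsRing_ball, abs, minus, plus, opp in Ht; simpl in Ht.
    assert (H3 := Rmin_l r (1 - r)).
    assert (H4 := Rmin_r r (1 - r)).
    assert (H5 := Rle_abs (t + - r)).
    assert (H6 := Rle_abs (- (t + - r))); rewrite Rabs_Ropp in H6.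
    symmetry; apply shot_eq; lra.
  + apply shot_int_derive.
- intros r Hr; apply shot_pow_derive; lra.
- rewrite slope_0; ring.
- intros r Hr; apply Rmult_lt_0_compat; [exact Hlam|apply shot_slope_pos; lra].
- intros r Hr; apply shot_pos; lra.
- intros r Hr; apply Rmult_lt_0_compat; [now apply pow_lt|].
  apply Hh_pos, shot_pos; lra.
- exact Hshoot1.
Qed.

(* [slope w r / r], extended by its limit at [0]. *)
Let mean (r : R) : R := if Rle_dec r 0 then h a else mass w r / r ^ N.
Let ratio (r : R) : R := nroot N (mean r).

Lemma shot_h_near (s : R) : 0 <= s -> Rabs (h (w s) - h a) <= Lh * (lam * rho) * s.
Proof.
intros Hs.
pose proof (shoot_admissible a Ha) as [Hlip [H0 _]]; fold w in Hlip, H0.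
assert (H1 := Hlip s 0); rewrite H0, Rminus_0_r, (Rabs_pos_eq s) in H1 by lra.
assert (H2 := Hh_lip (w s) a).
rewrite Rmult_assoc; apply Rle_trans with (1 := H2), Rmult_le_compat_l; lra.
Qed.

(** The point is [r = 0]: on [(0, t)] the density factor [h (w s)] is within [C * t] of [h a], which
    squeezes [mass w t] between [(h a - C * t) * t ^ N] and [(h a + C * t) * t ^ N]. *)
Lemma mean_cont (r : R) : 0 <= r -> continuity_pt mean r.
Proof.
intros [Hr | <-].
- apply (continuity_pt_ext_loc (fun s => mass w s / s ^ N)).
  + exists (mkposreal r Hr); intros t Ht.
    unfold ball in Ht; simpl in Ht;
      unfold AbsRing_ball, abs, minus, plus, opp in Ht; simpl in Ht.
    assert (H2 := Rle_abs (- (t + - r))); rewrite Rabs_Ropp in H2.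
    unfold mean; destruct (Rle_dec t 0); [lra|reflexivity].
  + apply (continuity_pt_div (mass w) (fun s => s ^ N)).
    * apply mass_cont, w_cont.
    * apply derivable_continuous_pt, derivable_pt_pow.
    * apply pow_nonzero; lra.
- set (C := Lh * (lam * rho)).
  assert (HC : 0 < C) by (unfold C; repeat apply Rmult_lt_0_compat; assumption).
  intros eps Heps; exists (eps / C); split; [now apply Rdiv_lt_0_compat|].
  simpl; unfold R_dist; intros t [_ Ht]; rewrite Rminus_0_r in Ht.
  assert (Hm0 : mean 0 = h a) by (unfold mean; destruct (Rle_dec 0 0); [reflexivity|lra]).
  rewrite Hm0; unfold mean; destruct (Rle_dec t 0) as [|Htp].
  { rewrite Rminus_diag, Rabs_R0; exact Heps. }
  rewrite (Rabs_pos_eq t) in Ht by lra.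
  apply Rlt_div_r in Ht; [|exact HC].
  assert (Htn : 0 < t ^ N) by (apply pow_lt; lra).
  assert (Hnear : forall s, 0 < s < t -> h a - C * t <= h (w s) <= h a + C * t).
  { intros s Hs; assert (H := shot_h_near s ltac:(lra)); fold C in H.
    apply Rabs_le_between in H.
    assert (C * s <= C * t) by (apply Rmult_le_compat_l; lra); lra. }
  assert (H1 : mass w t <= (h a + C * t) * t ^ N).
  { apply mass_le_pow; [exact w_cont|lra|intros s Hs; now apply Hnear]. }
  assert (H2 : (h a - C * t) * t ^ N <= mass w t).
  { apply mass_ge_pow; [exact w_cont|lra|intros s Hs; now apply Hnear]. }
  apply Rle_lt_trans with (C * t); [|lra].
  apply Rle_div_l in H1; [|exact Htn].
  apply Rle_div_r in H2; [|exact Htn].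
  apply Rabs_le; lra.
Qed.

Lemma ratio_cont (r : R) : 0 <= r -> continuity_pt ratio r.
Proof.
intros Hr; apply (continuity_pt_comp mean (nroot N)).
- now apply mean_cont.
- now apply nroot_continuity.
Qed.

Lemma shot_mass_pos (r : R) : 0 < r <= 1 -> 0 < mass w r.
Proof.
intros Hr; rewrite <- slope_pow; [|exact w_cont|lra].
now apply pow_lt, shot_slope_pos.
Qed.

Lemma ratio_pos (r : R) : 0 <= r <= 1 -> 0 < ratio r.
Proof.
intros Hr; apply nroot_pos; unfold mean; destruct (Rle_dec r 0).
- apply Hh_pos; lra.
- apply Rdiv_lt_0_compat; [apply shot_mass_pos; lra|apply pow_lt; lra].
Qed.

Lemma slope_ratio (r : R) : 0 < r <= 1 -> slope w r = r * ratio r.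
Proof.
intros Hr.
assert (Hrn : 0 < r ^ N) by (apply pow_lt; lra).
assert (Hrp := ratio_pos r ltac:(lra)).
assert (Heq : slope w r ^ N = (r * ratio r) ^ N).
{ rewrite slope_pow by (exact w_cont || lra).
  unfold ratio, mean; destruct (Rle_dec r 0); [lra|].
  rewrite Rpow_mult_distr, nroot_pow; [field; lra|exact HN|].
  apply Rdiv_le_0_compat; [apply Rlt_le, shot_mass_pos; lra|exact Hrn]. }
apply Rle_antisym; apply (pow_le_reg N); try exact HN; try lra.
- apply Rmult_le_pos; lra.
- apply slope_nonneg.
Qed.

(** The chain rule gives [slope * r^(N-1) * h / mass]; expressed through [ratio] the powers of [r]
    cancel, and the formula extends continuously to [0]. *)
Lemma shot_slope_derive (r : R) : 0 < r <= 1 ->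
  is_derive (slope w) r (h (w r) / ratio r ^ (N - 1)).
Proof.
intros Hr.
assert (Hmp := shot_mass_pos r Hr).
assert (Hrp := ratio_pos r ltac:(lra)).
assert (HNR : 0 < INR N) by (apply lt_0_INR; lia).
evar_last.
- apply (is_derive_comp (nroot N) (mass w)).
  + apply nroot_derive; [exact HN|exact Hmp].
  + apply mass_derive, w_cont.
- unfold scal; simpl; unfold mult; simpl.
  change (nroot N (mass w r)) with (slope w r).
  rewrite <- slope_pow by (exact w_cont || lra).
  rewrite slope_ratio by exact Hr.
  assert (HS : N = S (N - 1)) by lia.
  replace ((r * ratio r) ^ N) with (r * ratio r * (r ^ (N - 1) * ratio r ^ (N - 1))).
  + field; repeat split; try (apply pow_nonzero); lra.
  + rewrite HS at 3; rewrite <- Rpow_mult_distr; reflexivity.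
Qed.

Lemma shot_neg_convex_sol (f : R -> R) :
  (forall s, 0 <= s <= B -> h s = f s) -> shoot a 1 = 0 ->
  exists u, neg_convex_sol N f lam u.
Proof.
intros Hhf Hzero.
(* The primitive replaces [shoot a], which is constant beyond [[0, 1]], so that two-sided
   derivatives exist at the endpoints too. *)
pose (u := fun r => - (a - lam * RInt (slope w) 0 r)).
pose (u1 := fun r => lam * slope w r).
pose (u2 := fun r => lam * (h (w r) / ratio r ^ (N - 1))).
assert (Huw : forall r, 0 <= r <= 1 -> u r = - w r).
{ intros r Hr; unfold u; now rewrite <- shot_eq. }
assert (Hud : forall r, is_derive u r (u1 r)).
{ intros r; unfold u1; rewrite <- (Ropp_involutive (lam * slope w r)).
  apply (is_derive_opp (fun s => a - lam * RInt (slope w) 0 s)), shot_int_derive. }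
assert (Hneg : negative01 u).
{ intros r Hr; rewrite Huw by lra; generalize (shot_pos r ltac:(lra)); lra. }
assert (Hw1 : w 1 = 0) by exact Hzero.
exists u; split; [exists u1, u2; split; [split; [|split]|split; [|split]]|
  split; [|split; [exact Hneg|]]].
- intros x _; apply deriv_within_of_is_derive, Hud.
- intros x Hx; destruct (Req_dec x 0) as [-> |Hne].
  + assert (Hr0 := ratio_pos 0 ltac:(lra)).
    (* The difference quotient of [u1] at [0] is [lam * ratio t]; its limit agrees with the formula
       for [u2] because [ratio 0 ^ N = h a]. *)
    assert (Hu20 : u2 0 = lam * ratio 0).
    { unfold u2; f_equal.
      replace (w 0) with a by (symmetry; apply (shoot_admissible a Ha)).
      apply Rmult_eq_reg_r with (ratio 0 ^ (N - 1)); [|apply pow_nonzero; lra].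
      replace (ratio 0 * ratio 0 ^ (N - 1)) with (ratio 0 ^ N)
        by (replace N with (S (N - 1)) at 1 by lia; reflexivity).
      unfold Rdiv; rewrite Rmult_assoc, Rinv_l, Rmult_1_r by (apply pow_nonzero; lra).
      unfold ratio; rewrite nroot_pow; [|exact HN|].
      - unfold mean; destruct (Rle_dec 0 0); [reflexivity|lra].
      - unfold mean; destruct (Rle_dec 0 0); [apply Hh_nonneg|lra]. }
    rewrite Hu20; intros eps Heps.
    destruct (limit1_in_of_continuity_pt I01 ratio 0 (ratio_cont 0 ltac:(lra))
      (eps / lam) ltac:(now apply Rdiv_lt_0_compat)) as [d [Hd H]].
    exists d; split; [exact Hd|]; simpl in *; unfold R_dist in *.
    intros t [[HtI Htne] Ht]; unfold I01 in HtI.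
    specialize (H t (conj HtI Ht)).
    unfold u1; rewrite slope_0, slope_ratio by lra.
    replace ((lam * (t * ratio t) - lam * 0) / (t - 0) - lam * ratio 0)
      with (lam * (ratio t - ratio 0)) by (field; lra).
    rewrite Rabs_mult, (Rabs_pos_eq lam), Rmult_comm by lra.
    apply Rlt_div_r; [exact Hlam|exact H].
  + unfold I01 in Hx; apply deriv_within_of_is_derive.
    apply (is_derive_scal (slope w)), shot_slope_derive; lra.
- intros x Hx; unfold I01 in Hx; apply limit1_in_of_continuity_pt.
  apply (continuity_pt_scal (fun r => h (w r) / ratio r ^ (N - 1)) lam).
  apply (continuity_pt_div (fun r => h (w r)) (fun r => ratio r ^ (N - 1))).
  + apply (continuity_pt_comp w h); [apply w_cont|].
    exact (lipschitz_continuity h Lh Hh_lip (w x)).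
  + apply continuity_pt_pow_comp, ratio_cont; lra.
  + apply pow_nonzero, Rgt_not_eq, ratio_pos; lra.
- intros r Hr; apply is_derive_Reals.
  assert (Hwr := shot_pos r ltac:(lra)).
  (* A shot never exceeds its start [a <= B], so [h] and [f] agree along it. *)
  assert (Hwa : w r <= a) by apply (shoot_admissible a Ha).
  replace (lam ^ N * INR N * r ^ (N - 1) * f (- u r))
    with (INR N * r ^ (N - 1) * (lam ^ N * h (w r))).
  + apply shot_pow_derive; lra.
  + rewrite Huw, Ropp_involutive, Hhf by lra; ring.
- unfold u1; rewrite slope_0; ring.
- rewrite Huw by lra; lra.
- exists (1 / 2); split; [unfold I01; lra|].
  generalize (Hneg (1 / 2) ltac:(lra)); lra.
- apply (strictly_convex01_of_derive u u1); [intros; apply Hud|].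
  intros x y Hx Hxy Hy; apply Rmult_lt_compat_l; [exact Hlam|].
  apply (pow_lt_reg N); [apply slope_nonneg|].
  rewrite !slope_pow by (exact w_cont || lra).
  apply (derive_pos_incr (mass w) (fun s => INR N * s ^ (N - 1) * h (w s))).
  + exact Hxy.
  + intros s _; apply mass_cont, w_cont.
  + intros s _; apply mass_derive, w_cont.
  + intros s Hs; apply Rmult_lt_0_compat; [apply INR_pow_pos; [exact HN|lra]|].
    apply Hh_pos, shot_pos; lra.
Qed.

End Shot.

End Shooting.

(** * Sublinear nonlinearities *)

Lemma even_of_nonneg (N : nat) (f : R -> R) :
  (forall s, s <> 0 -> f s * s ^ N > 0) -> (forall s, 0 <= f s) -> Nat.Even N.
Proof.
intros Hf1 Hf; destruct (Nat.Even_or_Odd N) as [|[k ->]]; [assumption|exfalso].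
assert (H := Hf1 (-1) ltac:(lra)).
rewrite pow_add, pow_1_even in H; specialize (Hf (-1)); simpl in H; lra.
Qed.

(** The hypothesis on [df] is negativity of the derivative of [f s / s ^ N]; the cross-multiplied
    form matches the coefficient condition of [profile_compare]. *)
Lemma quotient_decr (N : nat) (f df : R -> R) :
  (1 <= N)%nat -> (forall s, derivable_pt_lim f s (df s)) ->
  (forall s, s > 0 -> df s < INR N * f s / s) ->
  forall s t, 0 < s -> s < t -> f t * s ^ N < f s * t ^ N.
Proof.
intros HN Hdf Hd s t Hs Hst.
assert (Hsn : 0 < s ^ N) by now apply pow_lt.
assert (Htn : 0 < t ^ N) by (apply pow_lt; lra).
assert (Hder : forall x, 0 < x -> is_derive (fun x => - (f x / x ^ N)) x
  (- ((df x * x ^ N - f x * (INR N * x ^ (N - 1) * 1)) / (x ^ N) ^ 2))).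
{ intros x Hx.
  apply (is_derive_opp (fun x => f x / x ^ N)), (is_derive_div f (fun x => x ^ N)).
  - now apply is_derive_Reals.
  - apply (is_derive_pow_Rmult (fun x => x)), (is_derive_id x).
  - apply pow_nonzero; lra. }
assert (H : - (f s / s ^ N) < - (f t / t ^ N)).
{ apply (derive_pos_incr (fun x => - (f x / x ^ N))
    (fun x => - ((df x * x ^ N - f x * (INR N * x ^ (N - 1) * 1)) / (x ^ N) ^ 2)));
    [exact Hst| | |].
  - intros x Hx; eapply derive_continuity_pt, Hder; lra.
  - intros x Hx; apply Hder; lra.
  - intros x Hx.
    assert (Hxn : 0 < x ^ N) by (apply pow_lt; lra).
    assert (Hxn2 : 0 < (x ^ N) ^ 2) by now apply pow_lt.
    unfold Rdiv; rewrite <- Ropp_mult_distr_l_reverse.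
    apply Rmult_lt_0_compat; [|now apply Rinv_0_lt_compat].
    specialize (Hd x ltac:(lra)).
    replace (f x * (INR N * x ^ (N - 1) * 1)) with (INR N * f x / x * x ^ N).
    + assert (df x * x ^ N < INR N * f x / x * x ^ N)
        by (apply Rmult_lt_compat_r; assumption).
      lra.
    + replace (x ^ N) with (x * x ^ (N - 1))
        by (replace N with (S (N - 1)) at 2 by lia; reflexivity).
      field; lra. }
apply Ropp_lt_cancel in H.
apply (proj1 (Rlt_div_l _ _ _ Htn)) in H.
replace (f s / s ^ N * t ^ N) with (f s * t ^ N / s ^ N) in H by (field; lra).
exact (proj2 (Rlt_div_r _ _ _ Hsn) H).
Qed.

(** Monotonicity bounds the quotient by its limit at [0]; passing through [s / 2] makes the bound
    strict, as the endpoint [lam = lam1 / f0] requires. *)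
Lemma quotient_lt_limit (N : nat) (f : R -> R) (l : R) :
  (forall s t, 0 < s -> s < t -> f t * s ^ N < f s * t ^ N) ->
  limit1_in (fun s => f s / s ^ N) (fun s => s <> 0) l 0 ->
  forall s, 0 < s -> f s < l * s ^ N.
Proof.
intros Hdec Hlim.
assert (Hq : forall s t, 0 < s -> s < t -> f t / t ^ N < f s / s ^ N).
{ intros s t Hs Hst.
  assert (Hsn : 0 < s ^ N) by now apply pow_lt.
  assert (Htn : 0 < t ^ N) by (apply pow_lt; lra).
  apply Rlt_div_l; [exact Htn|].
  replace (f s / s ^ N * t ^ N) with (f s * t ^ N / s ^ N) by (field; lra).
  apply Rlt_div_r; [exact Hsn|now apply Hdec]. }
assert (Hle : forall s, 0 < s -> f s / s ^ N <= l).
{ intros s Hs; apply Rnot_lt_le; intros Hlt.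
  destruct (Hlim (f s / s ^ N - l) ltac:(lra)) as [d [Hd H]].
  pose (t := Rmin (d / 2) (s / 2)).
  assert (Ht : 0 < t /\ t <= d / 2 /\ t <= s / 2).
  { unfold t, Rmin; destruct (Rle_dec (d / 2) (s / 2)); lra. }
  specialize (H t); simpl in H; unfold R_dist in H.
  rewrite Rminus_0_r, (Rabs_pos_eq t) in H by lra.
  specialize (H ltac:(lra)).
  specialize (Hq t s ltac:(lra) ltac:(lra)).
  generalize (Rle_abs (f t / t ^ N - l)); lra. }
intros s Hs.
assert (Hsn : 0 < s ^ N) by now apply pow_lt.
apply Rlt_div_l; [exact Hsn|].
apply Rlt_le_trans with (f (s / 2) / (s / 2) ^ N); [apply Hq; lra|apply Hle; lra].
Qed.

(** With [rho = B / (2 * lam)] a shot from [B] drops by at most [lam * rho = B / 2] on [[0, 1]],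
    hence is still positive at [1]. *)
Lemma sublinear_bound (N : nat) (f : R -> R) (lam B0 : R) :
  (1 <= N)%nat -> 0 < lam -> continuity f -> (forall s, 0 <= f s) ->
  (forall eps, eps > 0 -> exists M, forall s, Rabs s > M -> Rabs (f s / s ^ N) < eps) ->
  exists B, B0 < B /\ forall s, 0 <= s <= B -> f s <= (B / (2 * lam)) ^ N.
Proof.
intros HN Hlam Hcont Hf Hinf.
assert (Hk : 0 < / (2 * lam)) by (apply Rinv_0_lt_compat; lra).
destruct (Hinf ((/ (2 * lam)) ^ N) ltac:(now apply pow_lt)) as [M HM].
pose (M' := Rmax M 0).
assert (HM' : M <= M' /\ 0 <= M') by (unfold M'; split; [apply Rmax_l|apply Rmax_r]).
destruct (continuity_ab_maj f 0 (M' + 1)) as [x [Hx _]];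
  [lra|intros; apply Hcont|].
set (C := f x) in Hx.
assert (HC : 0 <= C) by apply Hf.
(* This gives [1 + C <= B / (2 * lam)], enough on [[0, M' + 1]] because a base at least [1] is below
   its [N]-th power; for larger [s] the limit yields [f s <= (s / (2 * lam)) ^ N]. *)
pose (B := Rabs B0 + 2 * lam * (1 + C)).
assert (HB : B0 < B).
{ unfold B; generalize (Rle_abs B0); intros.
  assert (0 < 2 * lam * (1 + C)) by (apply Rmult_lt_0_compat; lra); lra. }
assert (HBl : 1 + C <= B / (2 * lam)).
{ apply Rle_div_r; [lra|]; unfold B; generalize (Rabs_pos B0); lra. }
exists B; split; [exact HB|]; intros s Hs.
destruct (Rle_lt_dec s (M' + 1)) as [Hle|Hlt].
- apply Rle_trans with C; [apply Hx; lra|].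
  apply Rle_trans with (1 + C); [lra|].
  apply Rle_trans with ((1 + C) ^ N); [|apply pow_incr; lra].
  rewrite <- (pow_1 (1 + C)) at 1; apply Rle_pow; [lra|exact HN].
- assert (Hsn : 0 < s ^ N) by (apply pow_lt; lra).
  specialize (HM s); rewrite (Rabs_pos_eq s) in HM by lra; specialize (HM ltac:(lra)).
  assert (H := Rle_lt_trans _ _ _ (Rle_abs _) HM).
  apply (proj1 (Rlt_div_l _ _ _ Hsn)) in H.
  apply Rle_trans with ((/ (2 * lam)) ^ N * s ^ N); [lra|].
  rewrite <- Rpow_mult_distr; apply pow_incr; split; [nra|].
  unfold Rdiv; rewrite Rmult_comm; apply Rmult_le_compat_r; lra.
Qed.

Lemma quotient_large_near_0 (N : nat) (f : R -> R) (f0 lam lam1 : R) :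
  (1 <= N)%nat -> 0 < f0 -> 0 < lam1 -> lam1 / f0 < lam ->
  limit1_in (fun s => f s / s ^ N) (fun s => s <> 0) (f0 ^ N) 0 ->
  exists a, 0 < a /\ forall s, 0 < s <= a -> lam1 ^ N * s ^ N < lam ^ N * f s.
Proof.
intros HN Hf0 Hlam1 Hlt Hlim.
assert (Hlam : 0 < lam).
{ apply Rlt_trans with (2 := Hlt); now apply Rdiv_lt_0_compat. }
assert (Hq : 0 < lam1 / lam < f0).
{ split; [now apply Rdiv_lt_0_compat|].
  apply Rlt_div_l; [exact Hlam|]; rewrite Rmult_comm; now apply Rlt_div_l. }
assert (Hqn : (lam1 / lam) ^ N < f0 ^ N) by (apply pow_lt_compat; [exact HN|lra]).
destruct (Hlim (f0 ^ N - (lam1 / lam) ^ N) ltac:(lra)) as [d [Hd H]].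
exists (d / 2); split; [lra|]; intros s Hs.
assert (Hsn : 0 < s ^ N) by (apply pow_lt; lra).
assert (Hln : 0 < lam ^ N) by now apply pow_lt.
specialize (H s); simpl in H; unfold R_dist in H.
rewrite Rminus_0_r, (Rabs_pos_eq s) in H by lra.
specialize (H ltac:(lra)).
apply Rabs_def2 in H.
assert (H1 : (lam1 / lam) ^ N < f s / s ^ N) by lra.
apply (proj2 (Rlt_div_r _ _ _ Hsn)) in H1.
replace (lam1 ^ N * s ^ N) with (lam ^ N * ((lam1 / lam) ^ N * s ^ N)).
- apply Rmult_lt_compat_l; assumption.
- unfold Rdiv; rewrite Rpow_mult_distr, pow_inv; field; lra.
Qed.

Lemma C1_lipschitz_on (f df : R -> R) (B : R) :
  0 <= B -> (forall s, derivable_pt_lim f s (df s)) -> continuity df ->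
  exists L, 0 < L /\ forall s t, 0 <= s <= B -> 0 <= t <= B ->
    Rabs (f s - f t) <= L * Rabs (s - t).
Proof.
intros HB Hdf Hdfc.
destruct (continuity_ab_maj (fun s => Rabs (df s)) 0 B HB) as [x [Hx _]].
{ intros c _; apply (continuity_pt_comp df Rabs); [apply Hdfc|apply Rcontinuity_abs]. }
exists (Rabs (df x) + 1); split; [generalize (Rabs_pos (df x)); lra|].
intros s t Hs Ht.
destruct (MVT_abs f df t s) as [c [-> Hc]]; [intros; apply Hdf|].
apply Rmult_le_compat_r; [apply Rabs_pos|].
assert (0 <= c <= B); [|specialize (Hx c ltac:(lra)); simpl in Hx; lra].
revert Hc; unfold Rmin, Rmax; destruct (Rle_dec t s); lra.
Qed.

(** * Existence, ordering and nonexistence *)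

Lemma neg_convex_sol_exists (N : nat) (f df : R -> R) (f0 lam lam1 : R) :
  (1 <= N)%nat -> Nat.Even N ->
  (forall s, derivable_pt_lim f s (df s)) -> continuity df ->
  (forall s, 0 <= f s) -> (forall s, 0 < s -> 0 < f s) ->
  0 < f0 -> limit1_in (fun s => f s / s ^ N) (fun s => s <> 0) (f0 ^ N) 0 ->
  (forall eps, eps > 0 -> exists M, forall s, Rabs s > M -> Rabs (f s / s ^ N) < eps) ->
  0 < lam1 -> pos_eig N lam1 -> lam1 / f0 < lam ->
  exists u, neg_convex_sol N f lam u.
Proof.
intros HN Hev Hdf Hdfc Hf Hfpos Hf0 Hlim Hinf Hlam1 Heig Hlt.
assert (Hlam : 0 < lam).
{ apply Rlt_trans with (2 := Hlt); now apply Rdiv_lt_0_compat. }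
assert (Hcont : continuity f).
{ intros s; apply derivable_continuous_pt; exists (df s); apply Hdf. }
destruct (quotient_large_near_0 N f f0 lam lam1 HN Hf0 Hlam1 Hlt Hlim)
  as [amin [Hamin Hsmall]].
destruct (sublinear_bound N f lam amin HN Hlam Hcont Hf Hinf) as [B [HB Hbound]].
destruct (C1_lipschitz_on f df B ltac:(lra) Hdf Hdfc) as [Lh [HLh Hlip]].
destruct (continuity_ab_min f (amin / 2) B) as [x [Hx HxB]];
  [lra|intros; apply Hcont|].
pose (h := fun s => f (clamp 0 B s)).
assert (Hin : forall s, 0 <= clamp 0 B s <= B) by (intros; apply clamp_in; lra).
assert (Hhf : forall s, 0 <= s <= B -> h s = f s).
{ intros s Hs; unfold h; now rewrite clamp_id. }
assert (Hm : 0 < f x) by (apply Hfpos; lra).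
set (m := f x) in *.
assert (Hrho : 0 < B / (2 * lam)) by (apply Rdiv_lt_0_compat; lra).
set (rho := B / (2 * lam)) in *.
assert (Hh0 : forall s, 0 <= h s) by (intros s; apply Hf).
assert (Hhb : forall s, h s <= rho ^ N) by (intros s; apply Hbound, Hin).
assert (Hhl : forall s t, Rabs (h s - h t) <= Lh * Rabs (s - t)).
{ intros s t; unfold h; apply Rle_trans with (1 := Hlip _ _ (Hin s) (Hin t)).
  apply Rmult_le_compat_l; [lra|apply clamp_lipschitz; lra]. }
assert (Hhm : forall s, amin / 2 <= s <= B -> m <= h s).
{ intros s Hs; rewrite Hhf by lra; now apply Hx. }
assert (Hhp : forall s, 0 < s -> 0 < h s).
{ intros s Hs; apply Hfpos; unfold clamp, Rmax, Rmin.
  destruct (Rle_dec s B); destruct (Rle_dec 0 _); lra. }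
assert (HbigB : 0 < shoot N h lam B 1).
{ destruct (shoot_admissible N h lam rho Lh m amin B HN Hlam Hrho HLh Hm Hamin
    Hh0 Hhb Hhl Hhm B ltac:(lra)) as [HL [H0 _]].
  specialize (HL 1 0); rewrite H0, Rminus_0_r, Rabs_R1 in HL.
  replace (lam * rho * 1) with (B / 2) in HL by (unfold rho; field; lra).
  apply Rabs_le_between in HL; lra. }
(* Otherwise the shot would be a profile with values in [(0, amin]] on [(0, 1)], where
   [lam ^ N * f s] exceeds [lam1 ^ N * s ^ N]; the eigenfunction rules this out. *)
assert (Hsmalla : shoot N h lam amin 1 < 0).
{ apply Rnot_le_lt; intros Hge.
  assert (P2 := shot_profile N h lam rho Lh m amin B HN Hlam Hrho HLh Hm Hamin
    Hh0 Hhb Hhl Hhm amin ltac:(lra) Hhp Hge).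
  destruct (shoot_admissible N h lam rho Lh m amin B HN Hlam Hrho HLh Hm Hamin
    Hh0 Hhb Hhl Hhm amin ltac:(lra)) as [_ [_ Hle]].
  destruct (pos_eig_profile N lam1 HN Hev Hlam1 Heig) as [v [y [Hv1 P1]]].
  refine (profile_no_strict_sub N _ _ _ _ _ _ HN P1 P2 Hv1 _).
  intros t Ht; cbv beta.
  assert (Hvt := prof_w_pos _ _ _ _ P1 t Ht).
  assert (Hwt := prof_w_pos _ _ _ _ P2 t Ht).
  specialize (Hle t).
  rewrite Hhf by lra.
  assert (Hs := Hsmall _ (conj Hwt Hle)).
  assert (Hvn : 0 < v t ^ N) by now apply pow_lt.
  apply (Rmult_lt_compat_r _ _ _ Hvn) in Hs; lra. }
destruct (shoot_zero N h lam rho Lh m amin B HN Hlam Hrho HLh Hm Hamin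
  Hh0 Hhb Hhl Hhm HB Hsmalla HbigB) as [a [Ha Hza]].
exact (shot_neg_convex_sol N h lam rho Lh m amin B HN Hlam Hrho HLh Hm Hamin
  Hh0 Hhb Hhl Hhm a Ha Hhp ltac:(lra) f Hhf Hza).
Qed.

Lemma MO_sol_antitone (N : nat) (f : R -> R) (lam mu : R) (u v : R -> R) :
  (1 <= N)%nat -> Nat.Even N -> (forall s, 0 < s -> 0 < f s) ->
  (forall s t, 0 < s -> s < t -> f t * s ^ N < f s * t ^ N) ->
  0 < lam -> lam <= mu ->
  MO_sol N f lam u -> negative01 u -> MO_sol N f mu v -> negative01 v ->
  forall r, I01 r -> v r <= u r.
Proof.
intros HN Hev Hfpos Hdec Hlam Hmu Hu Hun Hv Hvn r Hr.
destruct (MO_sol_profile N f lam u HN Hev Hlam Hfpos Hu Hun) as [w1 [y1 [E1 P1]]].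
destruct (MO_sol_profile N f mu v HN Hev ltac:(lra) Hfpos Hv Hvn) as [w2 [y2 [E2 P2]]].
assert (H1 : w1 1 = 0).
{ rewrite E1 by (unfold I01; lra).
  destruct Hu as [? [? [_ [_ [_ Hu1]]]]]; lra. }
assert (H := profile_compare N _ _ _ _ _ _ HN P1 P2 H1).
cut (w1 r <= w2 r); [rewrite E1, E2 by exact Hr; lra|].
apply H; [|exact Hr].
intros t Ht Hlt.
assert (Hw1 := prof_w_pos _ _ _ _ P1 t Ht).
assert (Hw2 := prof_w_pos _ _ _ _ P2 t Ht).
assert (Hd := Hdec (w2 t) (w1 t) Hw2 Hlt).
assert (Hl : 0 < lam ^ N <= mu ^ N) by (split; [now apply pow_lt|apply pow_incr; lra]).
assert (0 < f (w1 t) * w2 t ^ N).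
{ apply Rmult_lt_0_compat; [now apply Hfpos|now apply pow_lt]. }
rewrite !Rmult_assoc; nra.
Qed.

(** The strict bound on [f] makes up for [lam * f0 <= lam1], which may be an equality, so the
    eigenfunction's coefficient strictly dominates. *)
Lemma no_negative_MO_sol (N : nat) (f : R -> R) (f0 lam lam1 : R) (u : R -> R) :
  (1 <= N)%nat -> Nat.Even N -> (forall s, 0 < s -> 0 < f s) -> 0 < f0 ->
  (forall s, 0 < s -> f s < f0 ^ N * s ^ N) ->
  0 < lam1 -> pos_eig N lam1 -> 0 < lam <= lam1 / f0 ->
  MO_sol N f lam u -> ~ negative01 u.
Proof.
intros HN Hev Hfpos Hf0 Hlt Hlam1 Heig [Hlam Hle] Hu Hun.
destruct (MO_sol_profile N f lam u HN Hev Hlam Hfpos Hu Hun) as [w [y [E P]]].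
destruct (pos_eig_profile N lam1 HN Hev Hlam1 Heig) as [v [z [_ Pv]]].
assert (H1 : w 1 = 0).
{ rewrite E by (unfold I01; lra).
  destruct Hu as [? [? [_ [_ [_ Hu1]]]]]; lra. }
refine (profile_no_strict_sub N _ _ _ _ _ _ HN P Pv H1 _).
intros t Ht; cbv beta.
assert (Hw := prof_w_pos _ _ _ _ P t Ht).
assert (Hv := pow_lt _ N (prof_w_pos _ _ _ _ Pv t Ht)).
assert (Hwn := pow_lt _ N Hw).
assert (Hln := pow_lt _ N Hlam).
apply (proj2 (Rle_div_r _ _ _ Hf0)) in Hle.
assert (Hlf : lam ^ N * f0 ^ N <= lam1 ^ N).
{ rewrite <- Rpow_mult_distr; apply pow_incr; split; [nra|exact Hle]. }
assert (H : lam ^ N * f (w t) < lam1 ^ N * w t ^ N).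
{ apply Rlt_le_trans with (lam ^ N * (f0 ^ N * w t ^ N)).
  - apply Rmult_lt_compat_l; [exact Hln|now apply Hlt].
  - rewrite <- Rmult_assoc; apply Rmult_le_compat_r; lra. }
apply (Rmult_lt_compat_r _ _ _ Hv) in H; lra.
Qed.

Theorem theorem5p3
  (N : nat) (HN : (1 <= N)%nat)
  (f df : R -> R)
  (* f ∈ C^1(R), with derivative df *)
  (Hdf : forall s, derivable_pt_lim f s (df s))
  (Hdfc : continuity df)
  (* (f1) *)
  (Hf1 : forall s, s <> 0 -> f s * s ^ N > 0)
  (* f_0 ∈ (0,∞), where f_0^N = lim_{s→0} f(s)/s^N *)
  (f0 : R) (Hf0pos : 0 < f0)
  (Hf0 : limit1_in (fun s => f s / s ^ N) (fun s => s <> 0) (f0 ^ N) 0)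
  (* f_∞ = 0 *)
  (Hfinf : forall eps, eps > 0 -> exists M, forall s,
             Rabs s > M -> Rabs (f s / s ^ N) < eps)
  (Hdpos : forall s, s > 0 -> df s < INR N * f s / s)
  (Hdneg : forall s, s < 0 -> df s > INR N * f s / s)
  (Hfnn : forall s, 0 <= f s)
  (lam1 : R) (Hlam1 : is_first_eigenvalue N lam1) :
  (forall lam, lam1 / f0 < lam ->
     exists u, neg_convex_sol N f lam u /\
       (forall v, neg_convex_sol N f lam v -> forall r, I01 r -> v r = u r))
  /\
  (forall lam mu u v, lam1 / f0 < lam -> lam < mu ->
     neg_convex_sol N f lam u -> neg_convex_sol N f mu v ->
     forall r, I01 r -> v r <= u r)
  /\
  (forall lam, 0 < lam <= lam1 / f0 ->
     forall u, MO_sol N f lam u -> ~ strictly_convex01 u).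
Proof.
assert (Hev : Nat.Even N) by exact (even_of_nonneg N f Hf1 Hfnn).
assert (Hfpos : forall s, 0 < s -> 0 < f s).
{ intros s Hs; specialize (Hf1 s ltac:(lra)).
  assert (0 < s ^ N) by now apply pow_lt.
  specialize (Hfnn s); nra. }
assert (Hdec := quotient_decr N f df HN Hdf Hdpos).
destruct Hlam1 as [Hlam1 [Heig _]].
assert (Hpos : forall lam, lam1 / f0 < lam -> 0 < lam).
{ intros lam; apply Rlt_trans; now apply Rdiv_lt_0_compat. }
split; [|split].
- intros lam Hlam.
  destruct (neg_convex_sol_exists N f df f0 lam lam1) as [u Hu]; try assumption.
  exists u; split; [exact Hu|]; intros v Hv r Hr.
  destruct Hu as [Hu [_ [Hun _]]]; destruct Hv as [Hv [_ [Hvn _]]].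
  apply Rle_antisym.
  + apply (MO_sol_antitone N f lam lam u v); auto; lra.
  + apply (MO_sol_antitone N f lam lam v u); auto; lra.
- intros lam mu u v Hlam Hmu [Hu [_ [Hun _]]] [Hv [_ [Hvn _]]] r Hr.
  apply (MO_sol_antitone N f lam mu u v); auto; lra.
- intros lam Hlam u Hu Hconv.
  apply (no_negative_MO_sol N f f0 lam lam1 u); try assumption.
  + apply quotient_lt_limit; assumption.
  + apply (strictly_convex01_negative N f lam); assumption.
Qed.
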